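(* Let $M$ be a Riemannian manifold, $f:M\to(-\infty,\infty]$ a function and $p\in M$. Then $f$ is (Fréchet) differentiable at $p$ if and only if $f$ is both subdifferentiable and superdifferentiable at $p$. In this case, $\{df(p)\}=D^{-}f(p)=D^{+}f(p)$.
   Context: A Riemannian manifold is a $C^\infty$ manifold modelled on a Hilbert space (possibly infinite-dimensional) with a $C^\infty$ assignment of scalar products on the tangent spaces inducing equivalent norms. For $f:M\to(-\infty,\infty]$ and $p\in\mathrm{dom}(f)=\{x:f(x)<\infty\}$, $D^{-}f(p)$ is the set of all $d\varphi(p)\in T^*M_p$ with $\varphi\in C^1(M,\mathbb{R})$ such that $f-\varphi$ attains a local minimum at $p$; $D^{+}f(p)$ is the set of all $d\varphi(p)$ with $\varphi\in C^1(M,\mathbb{R})$ such that $f-\varphi$ attains a local maximum at $p$. Sub- (super-) differentiability of $f$ is considered only at points of $\mathrm{dom}(f)$: $f$ is subdifferentiable (superdifferentiable) at $p$ if $p\in\mathrm{dom}(f)$ and $D^{-}f(p)\neq\emptyset$ ($D^{+}f(p)\ne\emptyset$). Differentiability at $p$ presupposes that $f$ is finite near $p$. *)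

(* Defs.v *)
From HB Require Import structures.
From mathcomp Require Import all_boot all_order all_algebra.
From mathcomp Require Import all_classical all_reals all_analysis.

Set Implicit Arguments.
Unset Strict Implicit.
Unset Printing Implicit Defensive.
Import Order.TTheory GRing.Theory Num.Theory.
Import numFieldNormedType.Exports.

Local Open Scope classical_set_scope.
Local Open Scope ring_scope.

Section BoundedLinear.
Context {R : realType} (E F : normedModType R).

Definition bounded_linear : {pred E -> F} :=
  fun f => `[< linear f /\ exists C, forall x, `|f x| <= C * `|x| >].

Record blinear := BLinear {
  blinear_fun :> E -> F;
  blinearP : blinear_fun \in bounded_linear }.

HB.instance Definition _ := [isSub for blinear_fun].
HB.instance Definition _ := [Choice of blinear by <:].

Fact bounded_linear_submod : submod_closed bounded_linear.
Proof.
split.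
  apply/asboolP; split=> [a x y|]; first exact/esym/(etrans (addr0 _))/scaler0.
  by exists 0 => x; rewrite mul0r [X in `|X|](_ : _ = 0)// normr0.
move=> a f g /asboolP[lf [C fC]] /asboolP[lg [D gD]]; apply/asboolP; split.
  move=> b x y /=; rewrite !fctE /= lf lg !scalerDr !scalerA (mulrC a b).
  by rewrite -!addrA; congr (_ + _); rewrite addrCA.
exists (`|a| * C + D) => x; rewrite !fctE /= mulrDl.
rewrite (le_trans (ler_normD _ _))// lerD// normrZ -mulrA.
by rewrite ler_wpM2l.
Qed.

HB.instance Definition _ := GRing.isSubmodClosed.Build _ _ bounded_linear
  bounded_linear_submod.
HB.instance Definition _ := [SubChoice_isSubLmodule of blinear by <:].

Lemma blinear_linear (f : blinear) : linear f.
Proof. by have /asboolP[] := blinearP f. Qed.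

HB.instance Definition _ (f : blinear) :=
  GRing.isLinear.Build R E F *:%R f (blinear_linear f).

Definition opnorm_bounds (f : blinear) : set R :=
  [set C | 0 <= C /\ forall x, `|f x| <= C * `|x|].

Definition opnorm (f : blinear) : R := inf (opnorm_bounds f).

Let has_inf_opnorm (f : blinear) : has_inf (opnorm_bounds f).
Proof.
split; last by exists 0 => C [].
have /asboolP[_ [C fC]] := blinearP f.
exists `|C|; split => // x; rewrite (le_trans (fC x))//.
by rewrite ler_wpM2r// ler_norm.
Qed.

Lemma opnorm_ge0 (f : blinear) : 0 <= opnorm f.
Proof. by apply: lb_le_inf; [have [] := has_inf_opnorm f|move=> C []]. Qed.

Lemma le_opnorm (f : blinear) x : `|f x| <= opnorm f * `|x|.
Proof.
have [->|x0] := eqVneq x 0; first by rewrite linear0 !normr0 mulr0.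
have xgt0 : 0 < `|x| by rewrite normr_gt0.
rewrite -ler_pdivrMr//; apply: lb_le_inf; first by have [] := has_inf_opnorm f.
by move=> C [_ fC]; rewrite ler_pdivrMr.
Qed.

Lemma opnorm_le (f : blinear) C :
  0 <= C -> (forall x, `|f x| <= C * `|x|) -> opnorm f <= C.
Proof.
by move=> C0 fC; apply: ge_inf => //; have [] := has_inf_opnorm f.
Qed.

Fact opnormD f g : opnorm (f + g) <= opnorm f + opnorm g.
Proof.
apply: opnorm_le => [|x]; first by rewrite addr_ge0 ?opnorm_ge0.
rewrite mulrDl (le_trans (ler_normD _ _))// lerD ?le_opnorm//.
Qed.

Fact opnormZ a f : opnorm (a *: f) = `|a| * opnorm f.
Proof.
apply/eqP; rewrite eq_le; apply/andP; split.
  apply: opnorm_le => [|x]; first by rewrite mulr_ge0 ?opnorm_ge0.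
  by rewrite normrZ -mulrA ler_wpM2l// le_opnorm.
have [->|a0] := eqVneq a 0; first by rewrite normr0 mul0r opnorm_ge0.
rewrite -ler_pdivlMl ?normr_gt0//; apply: opnorm_le => [|x].
  by rewrite mulr_ge0 ?invr_ge0 ?opnorm_ge0.
rewrite -mulrA ler_pdivlMl ?normr_gt0// -normrZ.
exact: (le_opnorm (a *: f)).
Qed.

Fact opnorm0_eq0 f : opnorm f = 0 -> f = 0.
Proof.
move=> f0; apply/val_inj/funext => x; apply/eqP; rewrite -normr_le0.
by rewrite (le_trans (le_opnorm f x))// f0 mul0r.
Qed.

HB.instance Definition _ :=
  Lmodule_isNormed.Build R blinear opnormD opnormZ opnorm0_eq0.

End BoundedLinear.

(* C^k maps on an open set U; the derivative is required to be C^(k-1) as a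
   map into the bounded linear maps with the operator norm. *)
Fixpoint Ck {R : realType} {E : normedModType R} (k : nat)
    {F : normedModType R} (U : set E) (f : E -> F) : Prop :=
  match k with
  | 0 => {within U, continuous f}
  | k'.+1 => exists2 df : E -> blinear E F,
      forall x, U x -> is_diff x f (df x) & Ck k' U df
  end.

Definition Csmooth {R : realType} {E F : normedModType R}
  (U : set E) (f : E -> F) : Prop := forall k, Ck k U f.

HB.mixin Record CompleteNormedModule_isHilbert (R : realType) H
    & CompleteNormedModule R H := {
  dot : H -> H -> R;
  dotC : forall u v, dot u v = dot v u;
  dot_scalar : forall u, scalar (dot u);
  dot_norm : forall u, dot u u = `|u| ^+ 2 }.

#[short(type="hilbertType")]
HB.structure Definition Hilbert (R : realType) :=
  {H of CompleteNormedModule R H & CompleteNormedModule_isHilbert R H}.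

(* A chart is a homeomorphism between an open subset of M and an open subset
   of H; chart_fun and chart_inv are arbitrary outside these subsets. *)
Record chart {R : realType} (M : topologicalType) (H : normedModType R) := Chart {
  chart_dom : set M;
  chart_cod : set H;
  chart_fun :> M -> H;
  chart_inv : H -> M;
  open_chart_dom : open chart_dom;
  open_chart_cod : open chart_cod;
  chart_dom_cod : forall x, chart_dom x -> chart_cod (chart_fun x);
  chart_cod_dom : forall y, chart_cod y -> chart_dom (chart_inv y);
  chart_funK : forall x, chart_dom x -> chart_inv (chart_fun x) = x;
  chart_invK : forall y, chart_cod y -> chart_fun (chart_inv y) = y;
  chart_fun_continuous : {within chart_dom, continuous chart_fun};
  chart_inv_continuous : {within chart_cod, continuous chart_inv} }.

Definition transition {R : realType} {M : topologicalType}
  {H : normedModType R} (c d : chart M H) : H -> H := d \o chart_inv c.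

Definition transition_dom {R : realType} {M : topologicalType}
    {H : normedModType R} (c d : chart M H) : set H :=
  chart_cod c `&` chart_inv c @^-1` chart_dom d.

Record hilbertManifold {R : realType} (H : hilbertType R) := HilbertManifold {
  manifold_sort :> topologicalType;
  manifold_hausdorff : hausdorff_space manifold_sort;
  atlas : set (chart manifold_sort H);
  atlas_cover : forall x, exists2 c, atlas c & chart_dom c x;
  atlas_compat : forall c d, atlas c -> atlas d ->
    Csmooth (transition_dom c d) (transition c d) }.

Lemma near_eq_diff {R : realType} {V W : normedModType R} (f g : V -> W)
    (x : V) : (\forall y \near x, f y = g y) -> differentiable f x ->
  differentiable g x /\ 'd g x = 'd f x :> (V -> W).
Proof.
move=> fg df; have fgx : f x = g x := nbhs_singleton fg.
have gE : g \o shift x = cst (g x) + 'd f x +o_ 0 id.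
  apply/eqaddoP => _/posnumP[e].
  have /eqaddoP/(_ e%:num) := diff_locally df.
  move=> /(_ (gt0 e)) fe; near=> h.
  rewrite !fctE /=; have <- : f (h + x) = g (h + x).
    near: h; move: fg; rewrite (near_shift 0 x) subr0.
    by apply: filterS => z /=.
  rewrite -fgx; near: h; exact: fe.
have dgE : 'd g x = 'd f x :> (V -> W).
  by apply: diff_unique => //; exact: diff_continuous.
split=> //; apply/diff_locallyP; rewrite dgE; split=> //.
exact: diff_continuous.
Unshelve. all: by end_near. Qed.

Lemma diff_near_comp {R : realType} {V W X : normedModType R} (t : V -> W)
    (g : W -> X) (f : V -> X) (x : V) :
  differentiable t x -> differentiable g (t x) ->
  (\forall y \near x, g (t y) = f y) ->
  forall h, 'd f x h = 'd g (t x) ('d t x h).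
Proof.
move=> dt dg fE h.
have [_ ->] := near_eq_diff fE (differentiable_comp dt dg).
by rewrite diff_comp.
Qed.

Section Tangent.
Context {R : realType} {H : hilbertType R} (M : hilbertManifold H).

Record chart_at (p : M) := ChartAt {
  chart_at_val :> chart M H;
  chart_at_atlas : atlas chart_at_val;
  chart_at_dom : chart_dom chart_at_val p }.

(* A tangent vector at p is the family of its coordinates in all the charts
   at p, which are related by the differentials of the transition maps. *)
Definition tangent_compat (p : M) : {pred chart_at p -> H} :=
  fun v => `[< forall c d : chart_at p, v d = 'd (transition c d) (c p) (v c) >].

Record tangent (p : M) := Tangent {
  tangent_coord :> chart_at p -> H;
  tangentP : tangent_coord \in @tangent_compat p }.

HB.instance Definition _ p := [isSub for @tangent_coord p].
HB.instance Definition _ p := [Choice of tangent p by <:].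

Fact tangent_submod p : submod_closed (@tangent_compat p).
Proof.
split; first by apply/asboolP => c d; apply/esym; exact: linear0.
move=> a u v /asboolP uP /asboolP vP; apply/asboolP => c d.
by rewrite !fctE /= linearP -uP -vP.
Qed.

HB.instance Definition _ p := GRing.isSubmodClosed.Build _ _ (@tangent_compat p)
  (tangent_submod p).
HB.instance Definition _ p := [SubChoice_isSubLmodule of tangent p by <:].

(* The topology of the tangent space is the one of H, through any chart. *)
Definition bounded_covector (p : M) : {pred tangent p -> R^o} :=
  fun xi => `[< scalar xi /\
    forall c : chart_at p, exists C, forall v, `|xi v| <= C * `|v c| >].

Record cotangent (p : M) := Cotangent {
  covector :> tangent p -> R^o;
  covectorP : covector \in @bounded_covector p }.

HB.instance Definition _ p := [isSub for @covector p].
HB.instance Definition _ p := [Choice of cotangent p by <:].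

Fact cotangent_submod p : submod_closed (@bounded_covector p).
Proof.
split.
  apply/asboolP; split=> [a x y|c]; first exact/esym/(etrans (addr0 _))/mulr0.
  by exists 0 => x; rewrite mul0r [X in `|X|](_ : _ = 0)// normr0.
move=> a f g /asboolP[lf fC] /asboolP[lg gD]; apply/asboolP; split.
  move=> b x y /=; rewrite !fctE /= lf lg !scalerDr.
  by rewrite mulrDr [a *: (b * _)]mulrCA -!addrA; congr (_ + _); rewrite addrCA.
move=> c; have [C {}fC] := fC c; have [D {}gD] := gD c.
exists (`|a| * C + D) => x; rewrite !fctE /= mulrDl.
rewrite (le_trans (ler_normD _ _))// lerD// normrZ -mulrA.
by rewrite ler_wpM2l.
Qed.

HB.instance Definition _ p :=
  GRing.isSubmodClosed.Build _ _ (@bounded_covector p) (cotangent_submod p).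
HB.instance Definition _ p := [SubChoice_isSubLmodule of cotangent p by <:].

Definition C1 (phi : M -> R) : Prop :=
  forall c, atlas c -> Ck 1 (chart_cod c) (phi \o chart_inv c : H -> R^o).

Definition mdifferentiable (phi : M -> R) (p : M) : Prop :=
  forall c : chart_at p, differentiable (phi \o chart_inv c : H -> R^o) (c p).

(* The unique covector given in every chart by the Frechet differential, see
   mdiffE; it is meaningful when phi is differentiable at p. *)
Definition mdiff (phi : M -> R) (p : M) : cotangent p :=
  xget 0 [set xi : cotangent p | forall (c : chart_at p) (v : tangent p),
    xi v = 'd (phi \o chart_inv c : H -> R^o) (c p) (v c)].

Lemma chart_at_exists p : inhabited (chart_at p).
Proof.
by have [c ac cp] := atlas_cover p; constructor; exact: ChartAt ac cp.
Qed.

Lemma transition_domP p (c d : chart_at p) : transition_dom c d (c p).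
Proof.
split; first exact/chart_dom_cod/chart_at_dom.
by rewrite /preimage /= chart_funK; exact: chart_at_dom.
Qed.

Lemma transition_differentiable p (c d : chart_at p) :
  differentiable (transition c d) (c p).
Proof.
have [df fdf _] := atlas_compat (chart_at_atlas c) (chart_at_atlas d) 1.
by have [] := fdf _ (transition_domP c d).
Qed.

Lemma transition_near p (c d : chart_at p) :
  \forall y \near c p, chart_inv d (transition c d y) = chart_inv c y.
Proof.
have [cp dp] := transition_domP c d.
have oc := open_chart_cod c; have od := open_chart_dom d.
have ivc : {for c p, continuous (chart_inv c)}.
  have := @chart_inv_continuous _ _ _ c; rewrite continuous_open_subspace//.
  by apply; rewrite inE.
have : nbhs (c p) (chart_inv c @^-1` chart_dom d).
  by apply: ivc; exact: open_nbhs_nbhs.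
by apply: filterS => y; exact: chart_funK.
Qed.

Lemma mdiff_transition (phi : M -> R) p (c d : chart_at p) :
  mdifferentiable phi p -> forall v : tangent p,
  'd (phi \o chart_inv c : H -> R^o) (c p) (v c) =
  'd (phi \o chart_inv d : H -> R^o) (d p) (v d).
Proof.
move=> dphi v; have /asboolP/(_ c d) -> := tangentP v.
have tcd : transition c d (c p) = d p.
  by rewrite /transition /= chart_funK//; exact: chart_at_dom.
have dd : differentiable (phi \o chart_inv d : H -> R^o) (transition c d (c p)).
  by rewrite tcd; exact: dphi.
rewrite -tcd; apply: (diff_near_comp (transition_differentiable c d) dd).
by apply: filterS (transition_near c d) => y /= ->.
Qed.

Lemma mdiffE (phi : M -> R) p : mdifferentiable phi p ->
  forall (c : chart_at p) (v : tangent p),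
  mdiff phi p v = 'd (phi \o chart_inv c : H -> R^o) (c p) (v c).
Proof.
move=> dphi; rewrite /mdiff; case: xgetP => [xi _ //|/(_ _) none].
have [c0] := chart_at_exists p.
pose L := 'd (phi \o chart_inv c0 : H -> R^o) (c0 p).
have Lb (c : chart_at p) : (fun v : tangent p => L (v c0)) \in @bounded_covector p.
  apply/asboolP; split=> [a u v|d]; first by rewrite -linearP.
  have Lc : continuous 'd (phi \o chart_inv d : H -> R^o) (d p).
    exact: diff_continuous.
  have /linear_boundedP := continuous_linear_bounded 0 (Lc 0).
  move=> /pinfty_ex_gt0[C _ LC]; exists C => v.
  by rewrite /L (mdiff_transition c0 d).
have [] := none (Cotangent (Lb c0)).
by move=> c v /=; rewrite (mdiff_transition c0 c).
Qed.

Lemma C1_mdifferentiable (phi : M -> R) p : C1 phi -> mdifferentiable phi p.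
Proof.
move=> phi1 c; have [df dfP _] := phi1 _ (chart_at_atlas c).
by have [] := dfP (c p) (chart_dom_cod (chart_at_dom c)).
Qed.

End Tangent.

(* metric_norm: the norm of the scalar product on the tangent space is
   equivalent to the one of H.  metric_smooth: in every chart the metric is a
   smooth map into the bounded bilinear forms on H. *)
Record riemannianManifold {R : realType} (H : hilbertType R) :=
  RiemannianManifold {
  riemannian_sort :> hilbertManifold H;
  metric : forall p : riemannian_sort, tangent p -> tangent p -> R;
  metricC : forall p (u v : tangent p), metric u v = metric v u;
  metric_scalar : forall p (u : tangent p), scalar (metric u);
  metric_gt0 : forall p (v : tangent p), v != 0 -> 0 < metric v v;
  metric_norm : forall p (c : chart_at p), exists2 C, 0 < C &
    forall v : tangent p,
      `|v c| <= C * Num.sqrt (metric v v) /\ Num.sqrt (metric v v) <= C * `|v c|;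
  metric_smooth : forall (c : chart riemannian_sort H) (ac : atlas c),
    exists2 G : H -> blinear H (blinear H R^o), Csmooth (chart_cod c) G &
    forall p (cp : chart_dom c p) (u v : tangent p),
      metric u v = G (c p) (u (ChartAt ac cp)) (v (ChartAt ac cp)) }.

Section Subdifferential.
Context {R : realType} {H : hilbertType R} {M : riemannianManifold H}.
Implicit Types (f : M -> \bar R) (p : M).

Definition edom f : set M := [set x | (f x < +oo)%E].

Definition Dminus f p : set (cotangent p) :=
  [set mdiff phi p | phi in [set phi : M -> R | C1 phi /\
    \forall x \near p, (f p - (phi p)%:E <= f x - (phi x)%:E)%E]].

Definition Dplus f p : set (cotangent p) :=
  [set mdiff phi p | phi in [set phi : M -> R | C1 phi /\
    \forall x \near p, (f x - (phi x)%:E <= f p - (phi p)%:E)%E]].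

Arguments Dminus f p : clear implicits.
Arguments Dplus f p : clear implicits.

Definition subdifferentiable f p : Prop := edom f p /\ Dminus f p !=set0.

Definition superdifferentiable f p : Prop := edom f p /\ Dplus f p !=set0.

Definition frechet_differentiable f p : Prop :=
  (\forall x \near p, f x \is a fin_num) /\ mdifferentiable (fine \o f) p.

Definition frechet_diff f p : cotangent p := mdiff (fine \o f) p.

End Subdifferential.

Arguments Dminus {R H M} f p.
Arguments Dplus {R H M} f p.

(* Main.v *)
Require Import Defs.
From HB Require Import structures.
From mathcomp Require Import all_boot all_order all_algebra.
From mathcomp Require Import all_classical all_reals all_analysis.
From mathcomp Require Import ring lra.

(** Everything rests on one comparison principle: if two functions that are
    differentiable at [p] touch there, one staying below the other, then their
    difference has a local extremum at [p] and their differentials agree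
    ([mdiff_touch]).  If [f] is both sub- and superdifferentiable at [p], it is
    squeezed between two C^1 functions touching at [p]; their differentials
    agree, hence [f] is differentiable with the same differential
    ([mdifferentiable_enclosed]).  If [f] is differentiable, the same principle
    shows that every element of [Dminus f p] and of [Dplus f p] is the
    differential of [f].

    What remains, and is the real work, is to produce for a function that is
    only differentiable at [p] two C^1 functions on the whole of [M] which
    enclose it near [p] and touch it at [p] ([C1_enclosure]).

    In a chart the function is [F p + L h + g h] with [g h = o(|h|)].  A C^1
    majorant of [|g|] is [theta h = 4 sigma(|h|)], where [sigma] is a primitive of
    a modulus [w] with [|g h| <= |h| w(|h|)]; see [C1_majorant].  The norm of a
    Hilbert space is smooth away from 0, and [w 0 = 0] takes care of the origin
    ([C1_at_radial]).  So [F p + L h - theta h] and [F p + L h + theta h] enclose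
    the function in the chart.

    To globalize these one multiplies by a bump function and extends by zero
    outside the chart ([C1_extension]).  The result is C^1 provided that a small
    closed ball of the chart is closed in [M].  In infinite dimension balls are
    not compact, and a Hausdorff manifold need not be regular, so this is where
    the Riemannian metric enters ([closed_chart_ball]): a point [q] in the closure
    of a small chart ball is joined to a point of that ball by an arbitrarily
    short segment of a chart at [q]; read in the chart at [p] this segment remains
    short, because both charts compare their norm with the metric
    ([metric_equiv]), and by completeness of the model space and the Hausdorff
    property it cannot leave the chart ([curve_trapped]).  Hence [q] is in the
    chart. *)

Set Implicit Arguments.
Unset Strict Implicit.
Unset Printing Implicit Defensive.
Import Order.TTheory GRing.Theory Num.Theory.
Import numFieldNormedType.Exports.

Local Open Scope classical_set_scope.
Local Open Scope ring_scope.

(** * Maps of class C^1 at a point *)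

Section Calculus.
Context {R : realType}.
Implicit Types E F G : normedModType R.

Lemma blinear_continuous E F (L : blinear E F) : continuous L.
Proof.
apply/bounded_linear_continuous/linear_boundedP.
near=> r => x; apply: le_trans (le_opnorm L x) _.
by rewrite ler_wpM2r//; near: r; apply: nbhs_pinfty_ge; rewrite num_real.
Unshelve. all: by end_near. Qed.

Lemma blinearBE E F (f g : blinear E F) x :
  (f - g) x = f x - g x.
Proof. by []. Qed.

(** The explicit estimate behind the Landau notation, the form in which
    differentials are computed below. *)
Lemma is_diffP E F (f : E -> F) (x : E) (L : blinear E F) :
  is_diff x f L <-> forall e, 0 < e ->
    \forall y \near x, `|f y - f x - L (y - x)| <= e * `|y - x|.
Proof.
have shiftP (e : R) :
    (\forall y \near x, `|f y - f x - L (y - x)| <= e * `|y - x|) <->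
    (\forall h \near 0, `|(f \o shift x - (cst (f x) + L)) h| <= e * `|h|).
  rewrite (near_shift 0 x) subr0; split; apply: filterS => h /=;
    by rewrite !fctE /= addrK opprD addrA.
split=> [[df dE] e e0|H].
  by apply/shiftP; have /eqaddoP := diff_locally df; rewrite dE; exact.
have gE : f \o shift x = cst (f x) + L +o_ 0 id.
  by apply/eqaddoP => e e0; apply/shiftP; exact: H.
have dE : 'd f x = L :> (E -> F).
  by apply: diff_unique gE; exact: blinear_continuous.
split=> //; apply/diff_locallyP; rewrite dE; split=> //.
exact: blinear_continuous.
Qed.

Lemma is_diff_inj E F (f : E -> F) x (L L' : blinear E F) :
  is_diff x f L -> is_diff x f L' -> L = L'.
Proof. by move=> [_ d1] [_ d2]; apply/val_inj; rewrite /= -d1 -d2. Qed.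

Lemma is_diff_subc E F (f : E -> F) a x (L : blinear E F) :
  is_diff x f L -> is_diff x (fun y => f y - a) L.
Proof.
move=> /is_diffP fL; apply/is_diffP => e /fL; apply: filterS => y.
by rewrite opprB addrA subrK.
Qed.

(** Being C^1 is local; the pointwise form of [Ck 1] makes it possible to glue
    functions defined by cases on open sets. *)
Definition C1_at E F (f : E -> F) (x : E) := exists2 df : E -> blinear E F,
  \forall y \near x, is_diff y f (df y) & {for x, continuous df}.

(** The local derivatives of [C1_at] glue to a global one because a
    differential is unique. *)
Lemma Ck1P E F (U : set E) (f : E -> F) : open U ->
  Ck 1 U f <-> forall x, U x -> C1_at f x.
Proof.
move=> oU; split=> [[df dfP dfc] x Ux|H].
  exists df.
    by near=> y; apply: dfP; near: y; exact: open_nbhs_nbhs.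
  by move: dfc; rewrite /= continuous_open_subspace//; apply; rewrite inE.
(* 0 is the value at the points outside U, where f may fail to be
   differentiable. *)
pose df (x : E) : blinear E F := xget 0 [set L : blinear E F | is_diff x f L].
have dfE x (L : blinear E F) : is_diff x f L -> df x = L.
  move=> fL; apply: is_diff_inj (fL); rewrite /df.
  by case: xgetP => [? _ //|/(_ L)/(_ fL)].
exists df => [x Ux|].
  have [df' df'P _] := H x Ux; have d := nbhs_singleton df'P.
  by rewrite (dfE _ _ d).
rewrite /= continuous_open_subspace// => x; rewrite inE => Ux.
have [df' df'P df'c] := H x Ux; have d := nbhs_singleton df'P.
rewrite /continuous_at (dfE _ _ d); apply: cvg_trans df'c.
apply: near_eq_cvg; apply: filterS df'P => y yP; exact/esym/dfE.
Unshelve. all: by end_near. Qed.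

Lemma near_eq_is_diff E F (f g : E -> F) x (L : E -> F) :
  (\forall y \near x, f y = g y) -> is_diff x f L -> is_diff x g L.
Proof.
move=> fg [df dE]; have [dg dgE] := near_eq_diff fg df.
by split; [exact: dg|exact: etrans dgE dE].
Qed.

Lemma near_eq_C1_at E F (f g : E -> F) x :
  (\forall y \near x, f y = g y) -> C1_at f x -> C1_at g x.
Proof.
move=> fg [df dfP dfc]; exists df => //.
by move: (near_join fg) dfP; apply: filterS2 => y; exact: near_eq_is_diff.
Qed.

Lemma C1_at_continuous E F (f : E -> F) x : C1_at f x -> {for x, continuous f}.
Proof. by move=> [df /nbhs_singleton[dP _] _]; exact: differentiable_continuous. Qed.

Lemma C1_at_cst E F (a : F) (x : E) : C1_at (cst a) x.
Proof.
exists (cst 0); last exact: cvg_cst.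
by near=> y; exact: is_diff_cst.
Unshelve. all: by end_near. Qed.

Lemma C1_at_linear E F (L : blinear E F) (x : E) : C1_at L x.
Proof.
exists (cst L); last exact: cvg_cst.
near=> y; apply/is_diffP => e e0; near=> z.
by rewrite linearB subrr normr0 mulr_ge0// ltW.
Unshelve. all: by end_near. Qed.

Lemma C1_atB E F (f g : E -> F) x : C1_at f x -> C1_at g x ->
  C1_at (fun y => f y - g y) x.
Proof.
move=> [df dfP dfc] [dg dgP dgc]; exists (fun y => df y - dg y).
  by move: dfP dgP; apply: filterS2 => y fy gy; exact: is_diffB.
exact: cvgB.
Qed.

Lemma C1_atM E (f g : E -> R^o) x : C1_at f x -> C1_at g x ->
  C1_at (fun y => f y * g y : R^o) x.
Proof.
move=> Cf Cg; have fc := C1_at_continuous Cf; have gc := C1_at_continuous Cg.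
case: Cf Cg => [df dfP dfc] [dg dgP dgc].
exists (fun y => f y *: dg y + g y *: df y).
  move: dfP dgP; apply: filterS2 => y fy gy.
  exact: (is_diff_eq (@is_diffM R E f g _ _ y fy gy) _).
by apply: cvgD; apply: cvgZ.
Qed.

Fact bcomp_subproof E F G (B : blinear F G) (A : blinear E F) :
  B \o A \in @bounded_linear R E G.
Proof.
apply/asboolP; split=> [a u v|]; first by rewrite /= !linearP.
exists (opnorm B * opnorm A) => x /=; apply: le_trans (le_opnorm _ _) _.
by rewrite -mulrA ler_wpM2l ?opnorm_ge0// le_opnorm.
Qed.

Definition bcomp E F G (B : blinear F G) (A : blinear E F) : blinear E G :=
  BLinear (bcomp_subproof B A).

Lemma normr_bcomp E F G (B : blinear F G) (A : blinear E F) :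
  `|bcomp B A| <= `|B| * `|A|.
Proof.
apply: opnorm_le => [|x]; first by rewrite mulr_ge0.
apply: le_trans (le_opnorm B (A x)) _; rewrite -mulrA.
by apply: ler_wpM2l; [exact: opnorm_ge0|exact: le_opnorm].
Qed.

Lemma cvg_bcomp T (Fl : set_system T) (FF : Filter Fl) E F G
    (B : T -> blinear F G) (A : T -> blinear E F) B0 A0 :
  B x @[x --> Fl] --> B0 -> A x @[x --> Fl] --> A0 ->
  bcomp (B x) (A x) @[x --> Fl] --> bcomp B0 A0.
Proof.
move=> cB cA.
have cb : `|B0 - B x| * `|A x| + `|B0| * `|A0 - A x| @[x --> Fl] --> (0 : R).
  have c0 : `|B0 - B x| @[x --> Fl] --> (0 : R).
    by rewrite -(@normr0 _ (blinear F G)) -(subrr B0);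
      apply: cvg_norm; apply: cvgB; [exact: cvg_cst|exact: cB].
  have d0 : `|A0 - A x| @[x --> Fl] --> (0 : R).
    by rewrite -(@normr0 _ (blinear E F)) -(subrr A0);
      apply: cvg_norm; apply: cvgB; [exact: cvg_cst|exact: cA].
  have := cvgD (cvgM c0 (cvg_norm cA)) (cvgM (cvg_cst `|B0|) d0).
  by rewrite mul0r mulr0 addr0; exact.
apply/cvgrPdist_le => e e0; move/cvgrPdist_le: cb => /(_ e e0).
apply: filterS => x; rewrite sub0r normrN => le; apply: le_trans le.
rewrite ger0_norm ?addr_ge0 ?mulr_ge0//.
have -> : bcomp B0 A0 - bcomp (B x) (A x) =
    bcomp (B0 - B x) (A x) + bcomp B0 (A0 - A x).
  apply/val_inj/funext => h /=.
  by rewrite !fctE /= linearB /= [RHS]addrC subrKA.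
by rewrite (le_trans (ler_normD _ _))// lerD// normr_bcomp.
Qed.

Lemma C1_at_comp E F G (f : E -> F) (g : F -> G) x :
  C1_at f x -> C1_at g (f x) -> C1_at (g \o f) x.
Proof.
move=> Cf Cg; have fc := C1_at_continuous Cf.
case: Cf Cg => [df dfP dfc] [dg dgP dgc].
exists (fun y => bcomp (dg (f y)) (df y)).
  have H : \forall y \near x, is_diff (f y) g (dg (f y)) := fc _ dgP.
  by move: dfP H; apply: filterS2 => y fy gy; exact: is_diff_comp.
by apply: cvg_bcomp => //; exact: (cvg_comp _ _ fc dgc).
Qed.

Lemma is_diff_real E (f : E -> R^o) (L : blinear E R^o) (s : R -> R) (s' : R) x :
  is_diff x f L -> is_derive (f x : R) 1 s s' ->
  is_diff x (fun y => s (f y) : R^o) (s' *: L).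
Proof.
move=> fx [sx sE].
have sd : is_diff (f x) (s : R -> R^o) ( *:%R^~ s').
  have /derivable1_diffP dd := sx; split=> //.
  by rewrite diff1E// derive1E sE.
apply: is_diff_eq (is_diff_comp fx sd) _.
by apply/funext => h /=; exact: mulrC.
Qed.

Fact bid_subproof E : idfun \in @bounded_linear R E E.
Proof. by apply/asboolP; split=> //; exists 1 => y; rewrite mul1r. Qed.

Definition bid E : blinear E E := BLinear (bid_subproof E).

Lemma C1_at_shift E F (f : E -> F) a x :
  C1_at f (x - a) -> C1_at (fun y => f (y - a)) x.
Proof.
move=> fx; apply: (@C1_at_comp _ _ _ (fun y => y - a)) fx.
exact: (C1_atB (C1_at_linear (bid E) x) (C1_at_cst a x)).
Qed.

Lemma differentiable_is_diff E F (f : E -> F) x : differentiable f x ->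
  exists L : blinear E F, is_diff x f L.
Proof.
move=> df; have Lc : continuous 'd f x by exact: diff_continuous.
have /linear_boundedP/pinfty_ex_gt0[C _ LC] := continuous_linear_bounded 0 (Lc 0).
have Lb : ('d f x : E -> F) \in @bounded_linear R E F.
  by apply/asboolP; split; [exact: linearP|exists C].
by exists (BLinear Lb).
Qed.

(** * Extrema, squeezing and quadratic remainders *)

(** If [L h < 0] then [f] decreases at first order along [h]. *)
Lemma local_min_diff0 E (f : E -> R^o) x (L : blinear E R^o) :
  is_diff x f L -> (\forall y \near x, (f x : R) <= f y) -> L = 0.
Proof.
move=> /is_diffP dfx fmin.
have Lge (h : E) : 0 <= (L h : R).
  rewrite leNgt; apply/negP => Lh.
  have h0 : h != 0 by apply/eqP => h0; rewrite h0 linear0 ltxx in Lh.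
  have hgt0 : 0 < `|h| by rewrite normr_gt0.
  (* Half of the slope of - L along h: the error then uses up at most half of
     the decrease. *)
  pose e := - (L h : R) / (2 * `|h|).
  have e0 : 0 < e by rewrite divr_gt0 ?oppr_gt0 ?mulr_gt0.
  have [a /= a0 ah] : exists2 a : R, 0 < a & forall y : E, `|x - y| < a ->
      `|f y - f x - L (y - x)| <= e * `|y - x| /\ (f x : R) <= f y.
    by have [a /= a0 H] := iffLR (nbhs_normP _ _) (filterI (dfx e e0) fmin); exists a.
  pose t := a / (2 * `|h|).
  have t0 : 0 < t by rewrite divr_gt0 ?mulr_gt0.
  have := ah (x + t *: h); rewrite opprD addNKr normrN [x + _ - x]addrAC subrr add0r.
  rewrite normrZ (gtr0_norm t0).
  have -> : t * `|h| = a / 2 by rewrite /t; field; rewrite gt_eqF.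
  have -> : L (t *: h) = t * (L h : R) by rewrite linearZ.
  have -> : e * (a / 2) = - (t * (L h : R)) / 2.
    by rewrite /e /t; field; rewrite gt_eqF.
  have : t * (L h : R) < 0 by rewrite pmulr_rlt0.
  set b := t * (L h : R) => b0.
  have a2 : a / 2 < a by rewrite ltr_pdivrMr// ltr_pMr// ltr1n.
  by move=> /(_ a2)[]; rewrite ler_norml => /andP[_ H1] H2; lra.
apply/val_inj/funext => h /=; apply/eqP; rewrite eq_le Lge andbT.
by rewrite -oppr_ge0; have := Lge (- h); rewrite linearN.
Qed.

Lemma squeeze_is_diff E (f u v : E -> R^o) x (L : blinear E R^o) :
  is_diff x u L -> is_diff x v L -> u x = f x -> v x = f x ->
  (\forall y \near x, (u y : R) <= f y /\ (f y : R) <= v y) -> is_diff x f L.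
Proof.
move=> /is_diffP du /is_diffP dv uf vf le; apply/is_diffP => e e0.
near=> y; have [uy fy] : (u y : R) <= f y /\ (f y : R) <= v y by near: y.
have : `|u y - u x - L (y - x)| <= e * `|y - x| by near: y; exact: du.
have : `|v y - v x - L (y - x)| <= e * `|y - x| by near: y; exact: dv.
rewrite uf vf !ler_norml => /andP[_ H1] /andP[H2 _].
move: H1 H2; set l := L _; rewrite -!/(_ - _ : R) => H1 H2.
by apply/andP; split; [apply: le_trans H2 _|apply: le_trans H1];
  rewrite !lerD2r.
Unshelve. all: by end_near. Qed.

(** Covers the points where a piecewise quadratic function changes its
    expression, without a case distinction. *)
Lemma is_derive_quadratic (f : R -> R) (a C t : R) :
  (forall h, `|f (t + h) - f t - a * h| <= C * h ^+ 2) -> is_derive t 1 f a.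
Proof.
move=> fC.
have fd : is_diff (t : R^o) (f : R^o -> R^o) (a *: bid R^o).
  apply/is_diffP => e e0; have C0 : 0 < `|C| + 1 by rewrite ltr_wpDl.
  have eC : 0 < e / (`|C| + 1) by rewrite divr_gt0.
  near=> y; have -> : y = t + (y - t) by rewrite subrKC.
  set h := y - t; rewrite [t + h - t]addrC addKr.
  apply: le_trans (fC h) _.
  rewrite -(real_normK (num_real (h : R))) expr2 mulrA; apply: ler_wpM2r => //.
  apply: (@le_trans _ _ ((`|C| + 1) * `|h|)).
    by rewrite ler_wpM2r// ler_wpDr// ler_norm.
  rewrite -ler_pdivlMl// /h distrC mulrC.
  by near: y; apply: cvgr_dist_le; [exact: cvg_id|exact: eC].
have [df dE] := fd.
split; first exact: diff_derivable.
by rewrite deriveE// dE /= [LHS]mulr1.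
Unshelve. all: by end_near. Qed.

End Calculus.

(** * Hilbert spaces and radial functions *)

Section HilbertCalculus.
Context {R : realType} {H : hilbertType R}.
Implicit Types u v w x y : H.

Lemma dotDr u v w : dot u (v + w) = dot u v + dot u w.
Proof. by have := dot_scalar u 1 v w; rewrite scale1r mul1r. Qed.

Lemma dot0r u : dot u 0 = 0.
Proof. by apply: (addrI (dot u 0)); rewrite -dotDr !addr0. Qed.

Lemma dotZr u a v : dot u (a *: v) = a * dot u v.
Proof. by have := dot_scalar u a v 0; rewrite dot0r !addr0. Qed.

Lemma dotNr u v : dot u (- v) = - dot u v.
Proof. by rewrite -scaleN1r dotZr mulN1r. Qed.

Lemma dotBr u v w : dot u (v - w) = dot u v - dot u w.
Proof. by rewrite dotDr dotNr. Qed.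

Lemma dotBl u v w : dot (u - v) w = dot u w - dot v w.
Proof. by rewrite dotC dotBr !(dotC w). Qed.

Lemma dotZl a u v : dot (a *: u) v = a * dot u v.
Proof. by rewrite dotC dotZr dotC. Qed.

Lemma cauchy_schwarz u v : `|dot u v| <= `|u| * `|v|.
Proof.
have le w : dot u w <= `|u| * `|w|.
  have [->|u0] := eqVneq u 0; first by rewrite dotC dot0r normr0 mul0r.
  have [->|w0] := eqVneq w 0; first by rewrite dot0r normr0 mulr0.
  have u0' : 0 < `|u| by rewrite normr_gt0.
  have w0' : 0 < `|w| by rewrite normr_gt0.
  have : 0 <= dot (`|w| *: u - `|u| *: w) (`|w| *: u - `|u| *: w).
    by rewrite dot_norm sqr_ge0.
  rewrite !(dotBl, dotBr, dotZl, dotZr) !dot_norm (dotC w u) => ge.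
  rewrite -subr_ge0 -(pmulr_rge0 _ (mulr_gt0 u0' w0')).
  by nra.
have := le (- v); rewrite dotNr normrN => le'.
by rewrite ler_norml le andbT lerNl.
Qed.

Fact riesz_subproof u : (dot u : H -> R^o) \in @bounded_linear R H R^o.
Proof.
apply/asboolP; split=> [a v w|]; first exact: dot_scalar.
by exists `|u| => v; exact: cauchy_schwarz.
Qed.

Definition riesz u : blinear H R^o := BLinear (riesz_subproof u).

Lemma normr_riesz u : `|riesz u| <= `|u|.
Proof. by apply: opnorm_le => // v; exact: cauchy_schwarz. Qed.

Lemma rieszB u v : riesz u - riesz v = riesz (u - v).
Proof. by apply/val_inj/funext => w /=; rewrite dotBl. Qed.

Lemma riesz_continuous : continuous riesz.
Proof.
move=> x; apply/cvgrPdist_le => e e0; near=> y.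
rewrite rieszB; apply: le_trans (normr_riesz _) _.
by near: y; apply: cvgr_dist_le.
Unshelve. all: by end_near. Qed.

Lemma is_diff_dot x : is_diff x (fun y => dot y y : R^o) (2 *: riesz x).
Proof.
apply/is_diffP => e e0; near=> y.
have -> : dot y y - dot x x - (2 *: riesz x) (y - x) = `|y - x| ^+ 2.
  rewrite -dot_norm /= !fctE /= !(dotBl, dotBr) (dotC y x) /=.
  by rewrite [2 *: _](_ : _ = 2 * (dot x y - dot x x))//; ring.
rewrite normrX normr_id expr2; apply: ler_wpM2r; first exact: normr_ge0.
rewrite distrC.
by near: y; apply: cvgr_dist_le.
Unshelve. all: by end_near. Qed.

Lemma is_diff_norm x : x != 0 ->
  is_diff x (fun y => `|y| : R^o) (`|x|^-1 *: riesz x).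
Proof.
move=> x0; have xgt0 : 0 < `|x| by rewrite normr_gt0.
have sq y : Num.sqrt (dot y y) = `|y| by rewrite dot_norm sqrtr_sqr normr_id.
have := is_diff_real (is_diff_dot x) (@is_derive1_sqrt _ (dot x x) _).
rewrite sq scalerA invfM mulrAC mulVf// mul1r.
under [X in is_diff _ X _]eq_fun do rewrite sq.
apply; by rewrite dot_norm exprn_gt0.
Qed.

(** The gradient of [s `|y|] is [s' `|y|] times a unit vector; at the origin,
    where the norm is not differentiable, it is continuous since [s' 0 = 0]. *)
Lemma C1_at_radial (s s' : R -> R) :
  (forall t : R, 0 <= t -> is_derive t 1 s (s' t)) ->
  (forall t : R, 0 <= t -> {for t, continuous s'}) -> s' 0 = 0 ->
  forall x, C1_at (fun y : H => s `|y| : R^o) x.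
Proof.
move=> ds s'c s'0 x.
have d0 : is_diff 0 (fun y : H => s `|y| : R^o) (0 : blinear H R^o).
  apply/is_diffP => e e0.
  have [/derivable1_diffP sd sE] := ds 0 (lexx 0).
  have /eqaddoP/(_ e e0) := diff_locally sd.
  rewrite diff1E// derive1E sE s'0 => near0.
  have near1 : \forall t \near (0 : R), `|s t - s 0| <= e * `|t|.
    by apply: filterS near0 => t; rewrite /= !fctE /= !addr0 scaler0 addr0.
  have n0 : `|y| @[y --> (0 : H)] --> (0 : R).
    by rewrite -(@normr0 _ H); exact: norm_continuous.
  have : \forall y \near (0 : H), `|s `|y| - s 0| <= e * `| `|y| | := n0 _ near1.
  by apply: filterS => y; rewrite normr_id normr0 /= !subr0.
(* At y = 0 this is 0, whatever the convention for the inverse of 0. *)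
exists (fun y => s' `|y| *: (`|y|^-1 *: riesz y)).
  near=> y; have [->|y0] := eqVneq y 0; first by rewrite normr0 s'0 scale0r.
  exact: is_diff_real (is_diff_norm y0) (ds _ (normr_ge0 y)).
have s'n (y : H) : s' `|z| @[z --> y] --> s' `|y|.
  exact: (cvg_comp _ _ (@norm_continuous _ H y) (s'c _ (normr_ge0 y))).
have [->|x0] := eqVneq x 0; last first.
  apply: cvgZ; first exact: s'n.
  apply: cvgZ; last exact: riesz_continuous.
  by apply: cvgV; [rewrite normr_eq0|exact: norm_continuous].
apply/cvgrPdist_le => e e0.
have := s'n 0; rewrite normr0 s'0 => /cvgrPdist_le/(_ e e0).
apply: filterS => y; rewrite scale0r !sub0r !normrN => le.
rewrite normrZ; apply: le_trans le.
rewrite ler_piMr// normrZ normfV normr_id.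
have [->|y0] := eqVneq y 0; first by rewrite normr0 invr0 mul0r.
by rewrite ler_pdivrMl ?normr_gt0// mulr1 normr_riesz.
Unshelve. all: by end_near. Qed.

End HilbertCalculus.

(** * C^1 majorants of functions that are o(|h|) *)

Section Primitive.
Context {R : realType}.

(** The integral starts at [-1], so that the derivative at 0 is two-sided. *)
Lemma continuous_primitive (w : R -> R) : continuous w ->
  exists2 s : R -> R, s 0 = 0 & forall t : R, 0 <= t -> is_derive t 1 s (w t).
Proof.
move=> wc; pose mu := @lebesgue_measure R.
pose F x := (\int[mu]_(t in `[(-1), x]) w t)%R.
exists (fun x => F x - F 0) => [|t t0]; first by rewrite subrr.
have [d dE] : derivable F t 1 /\ derive1 F t = w t.
  apply: (@continuous_FTC1_closed R w (-1) t (t + 1)).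
  - by rewrite ltrDl.
  - apply: continuous_compact_integrable; first exact: segment_compact.
    by apply: continuous_subspaceT.
  - by rewrite (lt_le_trans _ t0)// oppr_lt0.
  - exact: wc.
have dF : is_derive t 1 F (w t) := DeriveDef d (etrans (esym (derive1E F t)) dE).
have := is_deriveB dF (is_derive_cst (F 0) t 1).
by rewrite subr0.
Qed.

End Primitive.

Section Modulus.
Context {R : realType} {E : normedModType R} (g : E -> R) (d : R).
Hypothesis d_gt0 : 0 < d.
Hypothesis g_le : forall h, `|h| <= d -> `|g h| <= `|h|.
Hypothesis g_o : forall e, 0 < e -> exists2 a, 0 < a &
  forall h, `|h| <= a -> `|g h| <= e * `|h|.

(** The slope of [g] at [h], weighted by a factor that is 1 when
    [`|h| <= `|t|] and decays linearly in [t] for smaller [t].  Unlike the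
    supremum of the slopes over the ball of radius [t], the supremum of these
    quantities is continuous in [t].  At [h = 0] it is 0. *)
Definition damped_slope (h : E) (t : R) : R := `|g h| / `|h| * Num.min 1 (`|t| / `|h|).

Definition modulus (t : R) : R := sup [set damped_slope h t | h in [set h | `|h| <= d]].

Let min_ge0 (h : E) (t : R) : 0 <= Num.min 1 (`|t| / `|h|).
Proof. by rewrite le_min ler01 divr_ge0. Qed.

Let ratio_ge0 h : 0 <= `|g h| / `|h|. Proof. exact: divr_ge0. Qed.

Let ratio_le h e : `|g h| <= e * `|h| -> 0 <= e -> `|g h| / `|h| <= e.
Proof.
have [->|h0] := eqVneq h 0; first by rewrite normr0 invr0 !mulr0.
by rewrite ler_pdivrMr// normr_gt0.
Qed.

Let damped_slope_le1 h t : `|h| <= d -> damped_slope h t <= 1.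
Proof.
move=> hd; rewrite -[leRHS]mulr1; apply: ler_pM; 
  [exact: ratio_ge0|exact: min_ge0| |by rewrite ge_min lexx].
by apply: ratio_le => //; rewrite mul1r g_le.
Qed.

Lemma modulus_ge h t : `|h| <= d -> damped_slope h t <= modulus t.
Proof.
move=> hd; apply: ub_le_sup; last by exists h.
by exists 1 => _ [k kd <-]; exact: damped_slope_le1.
Qed.

Lemma modulus_le t C : (forall h, `|h| <= d -> damped_slope h t <= C) -> modulus t <= C.
Proof.
move=> H; apply: ge_sup; last by move=> _ [h hd <-]; exact: H.
by exists (damped_slope 0 t), 0 => //=; rewrite normr0 ltW.
Qed.

Lemma modulus_ge0 t : 0 <= modulus t.
Proof.
have h0 : `|0 : E| <= d by rewrite normr0 ltW.
by apply: le_trans (modulus_ge t h0); rewrite mulr_ge0.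
Qed.

Lemma modulus0 : modulus 0 = 0.
Proof.
apply/eqP; rewrite eq_le modulus_ge0 andbT; apply: modulus_le => h _.
by rewrite /damped_slope normr0 mul0r (min_r ler01) mulr0.
Qed.

Lemma modulus_norm h : `|h| <= d -> `|g h| <= `|h| * modulus `|h|.
Proof.
move=> hd; have [h0|h0] := eqVneq h 0.
  by move: (g_le hd); rewrite h0 normr0 mul0r.
have := modulus_ge `|h| hd.
rewrite /damped_slope normr_id divff ?normr_eq0// minxx mulr1.
by rewrite ler_pdivrMr ?normr_gt0// mulrC.
Qed.

Lemma modulus_mono s t : `|s| <= `|t| -> modulus s <= modulus t.
Proof.
move=> st; apply: modulus_le => h hd; apply: le_trans (modulus_ge t hd).
apply: ler_wpM2l => //; rewrite le_min !ge_min lexx /=.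
by rewrite ler_wpM2r ?orbT// invr_ge0.
Qed.

(** [modulus t / t] is nonincreasing in [t > 0]: this is what makes a primitive
    of the modulus comparable with [t * modulus t]. *)
Lemma modulus_double t : modulus t <= 2 * modulus (t / 2).
Proof.
apply: modulus_le => h hd.
apply: le_trans (_ : _ <= 2 * damped_slope h (t / 2)) _.
  rewrite /damped_slope mulrCA; apply: ler_wpM2l => //.
  rewrite minr_pMr// mulr1 normrM normfV (@ger0_norm _ 2)// mulrA mulrCA mulfV// mulr1.
  by rewrite le_min !ge_min lexx orbT ler1n.
by rewrite ler_pM2l// modulus_ge.
Qed.

(** Uniformly in [h], the weights are Lipschitz in [t] with a constant that
    depends only on a lower bound for [t]. *)
Lemma modulus_dist s t : t != 0 -> modulus s <= modulus t + `|s - t| / `|t|.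
Proof.
move=> t0; have tgt0 : 0 < `|t| by rewrite normr_gt0.
apply: modulus_le => h hd.
apply: le_trans (lerD (modulus_ge t hd) (lexx _)).
have [h0|h0] := eqVneq h 0.
  by rewrite /damped_slope h0 normr0 invr0 !mulr0 !mul0r add0r divr_ge0.
have hgt0 : 0 < `|h| by rewrite normr_gt0.
have rle : `|g h| / `|h| <= 1 by apply: ratio_le => //; rewrite mul1r g_le.
rewrite -lerBlDl -mulrBr; set m := _ - _.
have [m0|m0] := leP m 0.
  by apply: (@le_trans _ _ 0); [exact: mulr_ge0_le0|rewrite divr_ge0].
apply: le_trans (ler_piMl (ltW m0) rle) _; rewrite /m lerBlDl.
have [th|th] := leP 1 (`|t| / `|h|).
  by rewrite ge_min lerDl divr_ge0.
rewrite ge_min; apply/orP; right.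
have le1 : `|s| <= `|t| + `|s - t| by rewrite -[s in `|s|](subrKC t) ler_normD.
apply: (@le_trans _ _ ((`|t| + `|s - t|) / `|h|)).
  by rewrite ler_pM2r ?invr_gt0.
rewrite mulrDl lerD2l ler_wpM2l// lef_pV2 ?posrE//.
by move/ltW: th; rewrite ler_pdivrMr// mul1r.
Qed.

(** At 0, vectors of small norm contribute little because [g h] is [o(|h|)], and
    the others because of their weights. *)
Lemma modulus_continuous : continuous modulus.
Proof.
move=> t; apply/cvgrPdist_le => e e0.
have [->|t0] := eqVneq t 0.
  have e2 : 0 < e / 2 by rewrite divr_gt0.
  have [a a0 ga] := g_o e2.
  near=> s; rewrite modulus0 sub0r normrN (ger0_norm (modulus_ge0 s)).
  apply: modulus_le => h hd; have [ha|ha] := leP `|h| a.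
    apply: (@le_trans _ _ (e / 2 * 1)); last first.
      by rewrite mulr1 ler_pdivrMr// ler_peMr ?ler1n// ltW.
    apply: ler_pM; [exact: ratio_ge0|exact: min_ge0| |by rewrite ge_min lexx].
    by apply: ratio_le; [exact: ga|exact: ltW].
  have hgt0 : 0 < `|h| := lt_trans a0 ha.
  apply: (@le_trans _ _ (1 * (`|s| / a))).
    apply: ler_pM; [exact: ratio_ge0|exact: min_ge0| |].
      by apply: ratio_le => //; rewrite mul1r g_le.
    by rewrite ge_min ler_wpM2l ?orbT// lef_pV2 ?posrE// ltW.
  rewrite mul1r ler_pdivrMr//.
  near: s; apply: cvgr0_norm_le; [exact: cvg_id|exact: mulr_gt0].
have tgt0 : 0 < `|t| by rewrite normr_gt0.
near=> s.
have st : `|t - s| <= `|t| / 2.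
  by near: s; apply: cvgr_dist_le; rewrite ?divr_gt0.
have ste : `|t - s| <= e * (`|t| / 2).
  by near: s; apply: cvgr_dist_le; rewrite ?mulr_gt0 ?divr_gt0.
have sge : `|t| / 2 <= `|s|.
  have : `|t| <= `|s| + `|t - s| by rewrite -[t in `|t| <= _](subrKC s) ler_normD.
  by lra.
have sgt0 : 0 < `|s| by rewrite (lt_le_trans _ sge)// divr_gt0.
have s0 : s != 0 by rewrite -normr_gt0.
have le1 := modulus_dist t s0.
have le2 := modulus_dist s t0.
have b1 : `|t - s| / `|s| <= e.
  rewrite ler_pdivrMr//; apply: le_trans ste _.
  by rewrite ler_wpM2l// ltW.
have b2 : `|s - t| / `|t| <= e.
  rewrite distrC ler_pdivrMr//; apply: le_trans ste _.
  by rewrite ler_wpM2l ?(ltW e0)// ler_pdivrMr// ler_peMr// ler1n.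
by rewrite ler_norml; apply/andP; split; lra.
Unshelve. all: by end_near. Qed.

End Modulus.

Section Majorant.
Context {R : realType} {H : hilbertType R}.

(** With [w] the modulus of [g] and [s] its primitive, monotonicity gives
    [s t >= (t / 2) w (t / 2)], and [w t <= 2 w (t / 2)], whence
    [t w t <= 4 s t]. *)
Lemma C1_majorant (g : H -> R) :
  (forall e, 0 < e -> \forall h \near (0 : H), `|g h| <= e * `|h|) ->
  exists theta : H -> R^o, [/\ forall x, C1_at theta x, theta 0 = 0 &
    \forall h \near (0 : H), `|g h| <= theta h].
Proof.
move=> go.
have go' e : 0 < e -> exists2 a, 0 < a & forall h, `|h| <= a -> `|g h| <= e * `|h|.
  move=> /go/nbhs_norm0P[a /= a0 ga]; exists (a / 2); first by rewrite divr_gt0.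
  move=> h ha; apply: ga => /=; apply: le_lt_trans ha _.
  by rewrite ltr_pdivrMr// ltr_pMr// ltr1n.
have [d d0 gd] := go' 1 ltr01.
have {}gd h : `|h| <= d -> `|g h| <= `|h| by move/gd; rewrite mul1r.
pose w := modulus g d.
have w0 : w 0 = 0 by exact: modulus0.
have wc : continuous w by exact: modulus_continuous.
have [s s0 ds] := continuous_primitive wc.
have mvt t u : 0 <= t -> t <= u -> (u - t) * w t <= s u - s t.
  move=> t0 tu.
  have ds' x : x \in `]t, u[%R -> is_derive x 1 s (w x).
    by rewrite in_itv /= => /andP[tx _]; apply: ds; rewrite (le_trans t0)// ltW.
  have [|c ctu ->] := MVT_segment tu ds'.
    apply: derivable_within_continuous => x; rewrite in_itv /= => /andP[tx _].
    by have [] := ds x (le_trans t0 tx).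
  rewrite mulrC ler_wpM2r ?subr_ge0//; apply: modulus_mono => //.
  move: ctu; rewrite in_itv /= => /andP[tc _].
  by rewrite !ger0_norm// (le_trans t0).
have sge t : 0 <= t -> t * w t <= 4 * s t.
  move=> t0; have t20 : 0 <= t / 2 by rewrite divr_ge0.
  have t2t : t / 2 <= t by rewrite ler_pdivrMr// ler_peMr// ler1n.
  have h1 := mvt _ _ (lexx 0) t20; have h2 := mvt _ _ t20 t2t.
  have h3 : t * w t <= t * (2 * w (t / 2)).
    by rewrite ler_wpM2l//; exact: modulus_double.
  move: h1 h2; rewrite s0 w0 mulr0 !subr0 => h1 h2.
  have e : t - t / 2 = t / 2 by lra.
  move: h2; rewrite e => h2.
  apply: le_trans h3 _.
  rewrite (_ : t * (2 * w (t / 2)) = 4 * (t / 2 * w (t / 2))); last by field.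
  by rewrite ler_pM2l//; lra.
have ds4 (t : R) : 0 <= t -> is_derive t 1 (fun x => 4 * s x) (4 * w t).
  by move=> t0; apply: is_deriveZ; exact: ds.
have wc4 (t : R) : 0 <= t -> {for t, continuous (fun x => 4 * w x)}.
  by move=> _; apply: cvgM; [exact: cvg_cst|exact: wc].
have C4 := @C1_at_radial R H _ _ ds4 wc4 (etrans (congr1 _ w0) (mulr0 _)).
exists (fun h => 4 * s `|h|); split=> //; first by rewrite normr0 s0 mulr0.
apply/nbhs_norm0P; exists d => //= h /= /ltW hd.
by apply: le_trans (sge _ (normr_ge0 h)); exact: modulus_norm.
Qed.

End Majorant.

(** * Bump functions of class C^1 *)

Section Bump.
Context {R : realType} {H : hilbertType R}.

Let m (u : R) : R := Num.max 0 u.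

Let m_continuous : continuous m.
Proof.
have -> : m = fun u => (u + `|u|) / 2.
  apply/funext => u; rewrite /m; case: leP => u0.
    by rewrite ger0_norm//; lra.
  by rewrite ltr0_norm//; lra.
move=> u; apply: cvgM; last exact: cvg_cst.
by apply: cvgD; [exact: cvg_id|exact: norm_continuous].
Qed.

Let m_quadratic (u h : R) : `|m (u + h) ^+ 2 - m u ^+ 2 - 2 * m u * h| <= h ^+ 2.
Proof.
rewrite ler_norml /m; case: (leP 0 u) => u0; case: (leP 0 (u + h)) => uh;
  by apply/andP; split; nra.
Qed.

(** The quadratic spline with knots 1, 3/2 and 2 that is 1 before 1 and 0 after
    2. *)
Let b (t : R) := 1 - 2 * m (t - 1) ^+ 2 + 4 * m (t - 3 / 2) ^+ 2 - 2 * m (t - 2) ^+ 2.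
Let b' (t : R) := - 4 * m (t - 1) + 8 * m (t - 3 / 2) - 4 * m (t - 2).

Let b_quadratic (t h : R) : `|b (t + h) - b t - b' t * h| <= 8 * h ^+ 2.
Proof.
have := m_quadratic (t - 1) h; have := m_quadratic (t - 3 / 2) h.
have := m_quadratic (t - 2) h.
have sw (c : R) : t + h - c = t - c + h by rewrite addrAC.
rewrite /b /b' !sw.
rewrite !ler_norml => /andP[? ?] /andP[? ?] /andP[? ?].
by apply/andP; split; lra.
Qed.

Let b'_continuous : continuous b'.
Proof.
have mc (c : R) : continuous (fun t => m (t - c)).
  move=> t; have tc : (u - c) @[u --> t] --> t - c.
    by apply: cvgB; [exact: cvg_id|exact: cvg_cst].
  exact: (cvg_comp _ _ tc (@m_continuous _)).
move=> t; apply: cvgB; first apply: cvgD.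
- by apply: cvgM; [exact: cvg_cst|exact: mc].
- by apply: cvgM; [exact: cvg_cst|exact: mc].
- by apply: cvgM; [exact: cvg_cst|exact: mc].
Qed.

Lemma C1_bump (a : H) (r : R) : 0 < r -> exists beta : H -> R^o,
  [/\ forall x, C1_at beta x, forall x, `|x - a| <= r -> beta x = 1 &
    forall x, 2 * r <= `|x - a| -> beta x = 0].
Proof.
move=> r0; pose s t := b (t / r); pose s' t := b' (t / r) / r.
have ds (t : R) : 0 <= t -> is_derive t 1 s (s' t).
  move=> _; apply: (@is_derive_quadratic _ _ _ (8 / r ^+ 2)) => h.
  rewrite /s /s' mulrDl mulrAC -mulrA.
  apply: le_trans (b_quadratic _ _) _.
  by rewrite exprMn exprVn mulrA mulrAC.
have sc (t : R) : 0 <= t -> {for t, continuous s'}.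
  move=> _; apply: cvgM; last exact: cvg_cst.
  have tr : (u / r) @[u --> t] --> t / r.
    by apply: cvgM; [exact: cvg_id|exact: cvg_cst].
  exact: (cvg_comp _ _ tr (@b'_continuous _)).
have s'0 : s' 0 = 0.
  by rewrite /s' mul0r /b' /m !max_l; lra.
have C := @C1_at_radial R H s s' ds sc s'0.
exists (fun x => s `|x - a|); split=> x.
- by apply: (@C1_at_shift _ _ _ (fun y => s `|y|)); exact: C.
- move=> xr; have le : `|x - a| / r <= 1 by rewrite ler_pdivrMr// mul1r.
  rewrite /s /b; move: le; set t := _ / r => le.
  by rewrite /m !max_l; lra.
- rewrite -ler_pdivlMr// => le; rewrite /s /b; move: le; set t := _ / r => le.
  by rewrite /m !max_r; lra.
Qed.

End Bump.

(** * Curves trapped in a chart *)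

Section Charts.
Context {R : realType} (M : topologicalType) (E : normedModType R).

Lemma chart_inv_continuous_at (c : chart M E) y : chart_cod c y ->
  {for y, continuous (chart_inv c)}.
Proof.
move=> cy; have := @chart_inv_continuous _ _ _ c.
rewrite continuous_open_subspace; last exact: open_chart_cod.
by apply; rewrite inE.
Qed.

Lemma chart_fun_continuous_at (c : chart M E) x : chart_dom c x ->
  {for x, continuous c}.
Proof.
move=> cx; have := @chart_fun_continuous _ _ _ c.
rewrite continuous_open_subspace; last exact: open_chart_dom.
by apply; rewrite inE.
Qed.

Lemma near_chart_cod (c : chart M E) y : chart_cod c y ->
  \forall z \near y, chart_cod c z.
Proof. by move=> cy; apply: open_nbhs_nbhs; split=> //; exact: open_chart_cod. Qed.

Lemma near_chart_dom (c : chart M E) x : chart_dom c x ->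
  \forall z \near x, chart_dom c z.
Proof. by move=> cx; apply: open_nbhs_nbhs; split=> //; exact: open_chart_dom. Qed.

End Charts.

Section Curves.
Context {R : realType} {H : hilbertType R}.

(** The mean value inequality, from the real mean value theorem applied to the
    scalar product of the curve with its total displacement. *)
Lemma curve_lipschitz (f : R -> H) (L a b : R) : a <= b ->
  (forall t, a <= t <= b -> derivable f t 1 /\ `|'D_1 f t| <= L) ->
  `|f b - f a| <= L * (b - a).
Proof.
move=> ab fL; set w := f b - f a.
have dphi (t : R) : a <= t <= b -> 
    is_derive t 1 (fun u => dot w (f u)) (dot w ('D_1 f t)).
  move=> /fL[df _]; have df' : differentiable f t by apply/derivable1_diffP.
  have [dr drE] : is_diff (f t) (riesz w) (riesz w).
    apply/is_diffP => e e0; near=> y.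
    by rewrite linearB subrr normr0 mulr_ge0// ltW.
  have dc : differentiable ((riesz w : H -> R) \o f) t by exact: differentiable_comp.
  split; first exact: diff_derivable.
  rewrite -[LHS]/('D_1 ((riesz w : H -> R) \o f) t) deriveE// diff_comp//= drE.
  by rewrite deriveE.
have [||c cab] := @MVT_segment R (fun u => dot w (f u))
  (fun t => dot w ('D_1 f t)) _ _ ab.
- by move=> t; rewrite in_itv /= => /andP[ta tb]; apply: dphi; rewrite !ltW.
- apply: derivable_within_continuous => t; rewrite in_itv /= => tab.
  by have [] := dphi t tab.
move: cab; rewrite in_itv /= => cab.
rewrite -dotBr dot_norm => wE; have [_ cL] := fL c cab.
have [w0|w0] := eqVneq w 0.
  by rewrite w0 normr0 mulr_ge0 ?subr_ge0// (le_trans _ cL).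
rewrite -(ler_pM2l (x := `|w|)) ?normr_gt0// -expr2 wE mulrA.
apply: ler_wpM2r; first by rewrite subr_ge0.
apply: le_trans (ler_norm _) (le_trans (cauchy_schwarz _ _) _).
exact: ler_wpM2l.
Unshelve. all: by end_near. Qed.

(** As long as the curve [gam] stays in the ball of radius [r] of the chart it is
    [L]-Lipschitz there, so that it does not approach the boundary of the ball.
    At the supremum [T] of the times up to which it stays in the ball, its
    coordinates converge in the complete space [H]; as limits are unique in [M],
    the limit is the coordinate of [gam T].  So [gam T] is still in the open ball,
    and [T = 1]. *)
Lemma curve_trapped (M : topologicalType) (c : chart M H) (a : H) (r L : R)
    (gam : R -> M) : hausdorff_space M -> 0 <= L ->
  (forall y, `|y - a| < r -> chart_cod c y) ->
  (forall t, 0 <= t <= 1 -> {for t, continuous gam}) ->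
  (forall t, 0 <= t <= 1 -> chart_dom c (gam t) -> `|c (gam t) - a| < r ->
    derivable (c \o gam : R -> H) t 1 /\ `|'D_1 (c \o gam : R -> H) t| <= L) ->
  chart_dom c (gam 0) -> `|c (gam 0) - a| + L < r ->
  chart_dom c (gam 1).
Proof.
move=> hM L0 cball gamc dgam dom0 lt_r.
pose W t := chart_dom c (gam t) /\ `|c (gam t) - a| < r.
pose P t := forall s, 0 <= s <= t -> W s.
have W0 : W 0 by split=> //; apply: le_lt_trans lt_r; rewrite lerDl.
have P0 : P 0.
  by move=> s /andP[s0 s0']; rewrite (_ : s = 0)//; apply/le_anti/andP.
have lip t s s' : P t -> t <= 1 -> 0 <= s -> s <= s' -> s' <= t ->
    `|c (gam s') - c (gam s)| <= L * (s' - s).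
  move=> Pt t1 s0 ss' s't; apply: (@curve_lipschitz (c \o gam)) => // u /andP[su us'].
  have u0 := le_trans s0 su; have ut := le_trans us' s't.
  have [|domu au] := Pt u; first by rewrite u0.
  by apply: dgam => //; rewrite u0 (le_trans ut).
pose S := [set t | 0 <= t <= 1 /\ P t].
have S0 : S 0 by split=> //; rewrite lexx ltW.
have Sub : has_sup S.
  by split; [exists 0|exists 1 => t [/andP[]]].
set T := sup S.
have T0 : 0 <= T by apply: ub_le_sup => //; exact: Sub.2.
have T1 : T <= 1 by apply: ge_sup; [exists 0|move=> t [/andP[]]].
have PltT t : t < T -> P t.
  move=> tT; have T't : 0 < T - t by rewrite subr_gt0.
  have [u [_ Pu]] := sup_adherent T't Sub.
  rewrite opprB addrC subrK => tu s /andP[s0 st].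
  by apply: Pu; rewrite s0 (le_trans st)// ltW.
have WT : W T.
  have [T_eq0|T_neq0] := eqVneq T 0; first by rewrite T_eq0.
  have Tgt0 : 0 < T by rewrite lt_neqAle eq_sym T_neq0.
  pose F := (c (gam s) @[s --> T^'-]).
  have Fcauchy : cauchy F.
    apply: cauchy_exP => e e0.
    have eL : 0 < e / (L + 1) by rewrite divr_gt0// ltr_wpDl.
    pose s0 := Num.max 0 (T - e / (L + 1)).
    have s0T : s0 < T by rewrite /s0 gt_max Tgt0 gtrBl.
    have s00 : 0 <= s0 by rewrite /s0 le_max lexx.
    exists (c (gam s0)).
    suff : \forall s \near T^'-, ball (c (gam s0)) e (c (gam s)) by [].
    near=> s.
    have sT : s < T by near: s; exact: nbhs_left_lt.
    have s0s : s0 <= s by near: s; exact: nbhs_left_ge.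
    rewrite -ball_normE /ball_ /= distrC.
    apply: le_lt_trans (lip s _ _ (PltT s sT) _ s00 s0s (lexx s)) _.
      by rewrite (le_trans _ T1)// ltW.
    have le1 : s - s0 <= e / (L + 1).
      have : T - e / (L + 1) <= s0 by rewrite /s0 le_max lexx orbT.
      by lra.
    apply: (@le_lt_trans _ _ (L * (e / (L + 1)))); first exact: ler_wpM2l.
    by rewrite mulrCA gtr_pMr// ltr_pdivrMr ?mul1r ?ltrDl// ltr_wpDl.
  have /cauchy_cvgP/cvg_ex[y Fy] := Fcauchy.
  have yr : `|y - a| < r.
    pose K := `|c (gam 0) - a| + L.
    have rK : 0 < (r - K) / 2 by rewrite divr_gt0// subr_gt0.
    near T^'- => s.
    have sT : s < T by near: s; exact: nbhs_left_lt.
    have s0 : 0 <= s by near: s; exact: nbhs_left_ge.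
    have s1 : s <= 1 by rewrite (le_trans _ T1)// ltW.
    have h1 : `|y - c (gam s)| <= (r - K) / 2.
      by near: s; move/cvgrPdist_le : Fy; apply.
    have h2 := lip s _ _ (PltT s sT) s1 (lexx 0) s0 (lexx s).
    have h3 : L * (s - 0) <= L by rewrite subr0 ler_piMr.
    have -> : y - a = (y - c (gam s)) + ((c (gam s) - c (gam 0)) + (c (gam 0) - a)).
      by rewrite !subrKA.
    have h4 := ler_normD (y - c (gam s)) ((c (gam s) - c (gam 0)) + (c (gam 0) - a)).
    have h5 := ler_normD (c (gam s) - c (gam 0)) (c (gam 0) - a).
    have Kr : K < r by [].
    by move: Kr h1; rewrite /K => Kr h1; lra.
  have cody : chart_cod c y by exact: cball.
  have ivc := chart_inv_continuous_at cody.
  have lim1 : gam s @[s --> T^'-] --> chart_inv c y.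
    have := cvg_comp _ _ Fy ivc; apply: cvg_trans; apply: near_eq_cvg.
    near=> s => /=; rewrite chart_funK//.
    have sT : s < T by near: s; exact: nbhs_left_lt.
    have s0 : 0 <= s by near: s; exact: nbhs_left_ge.
    by have [] := PltT s sT s; rewrite ?s0 ?lexx.
  have lim2 : gam s @[s --> T^'-] --> gam T.
    by apply: cvg_at_left_filter; apply: gamc; rewrite T0.
  have gamT : gam T = chart_inv c y := cvg_unique hM lim2 lim1.
  have domT : chart_dom c (gam T) by rewrite gamT; exact: chart_cod_dom.
  by split=> //; rewrite gamT chart_invK.
have [T_eq1|T_neq1] := eqVneq T 1; first by have [] := WT; rewrite T_eq1.
have Tlt1 : T < 1 by rewrite lt_neqAle T_neq1.
have T01 : 0 <= T <= 1 by rewrite T0.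
have [domT aT] := WT.
have Wnear : \forall s \near T, W s.
  have n1 : \forall s \near T, chart_dom c (gam s).
    exact: (gamc T T01 _ (near_chart_dom domT)).
  have [/derivable1_diffP dcg _] := dgam T T01 domT aT.
  have n2 : \forall s \near T, `|(c \o gam) s - a| < r.
    have cc := differentiable_continuous dcg.
    have : `|(c \o gam) s - a| @[s --> T] --> `|(c \o gam) T - a|.
      by apply: cvg_norm; apply: cvgB; [exact: cc|exact: cvg_cst].
    by move/cvgr_lt; apply.
  by near=> s; split; near: s.
have [e /= e0 eW] : exists2 e : R, 0 < e & forall s, `|T - s| < e -> W s.
  by have [e /= e0 eW] := iffLR (nbhs_normP _ _) Wnear; exists e.
pose t := Num.min 1 (T + e / 2).
have e2 : 0 < e / 2 by rewrite divr_gt0.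
have tT : T < t by rewrite /t lt_min Tlt1 ltrDl.
have t1 : t <= 1 by rewrite /t ge_min lexx.
have St : S t.
  split; first by rewrite t1 (le_trans T0)// ltW.
  move=> s /andP[s0 st]; have [sT|Ts] := ltP s T.
    by apply: (PltT s sT); rewrite s0 lexx.
  apply: eW; rewrite ler0_norm ?subr_le0// opprB.
  have : t <= T + e / 2 by rewrite /t ge_min lexx orbT.
  by lra.
have : t <= T by apply: ub_le_sup => //; exact: Sub.2.
by rewrite leNgt tT.
Unshelve. all: by end_near. Qed.

End Curves.

(** * Tangent vectors and the metric in charts *)

Section TangentVectors.
Context {R : realType} {H : hilbertType R} (M : hilbertManifold H).

Lemma transition_chart (p : M) (c d : chart_at p) : transition c d (c p) = d p.
Proof. by rewrite /transition /= chart_funK//; exact: chart_at_dom. Qed.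

Lemma diff_transition_id (p : M) (c : chart_at p) w :
  'd (transition c c) (c p) w = w.
Proof.
have : \forall y \near c p, id y = transition c c y.
  apply: filterS (near_chart_cod (chart_dom_cod (chart_at_dom c))) => y cy.
  by rewrite /transition /= chart_invK.
by move=> /near_eq_diff[|_ ->]; [exact: ex_diff|rewrite diff_val].
Qed.

(** The cocycle relation between transition maps makes the family of images of
    [w] compatible. *)
Lemma tangent_exists (p : M) (c : chart_at p) (w : H) : exists v : tangent p, v c = w.
Proof.
pose v (d : chart_at p) := 'd (transition c d) (c p) w.
have vP : v \in @tangent_compat _ _ M p.
  apply/asboolP => d e; rewrite /v -(transition_chart c d).
  apply: diff_near_comp; first exact: transition_differentiable.
    by rewrite transition_chart; exact: transition_differentiable.
  by apply: filterS (transition_near c d) => y yE; rewrite /transition /= yE.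
by exists (Tangent vP); exact: diff_transition_id.
Qed.

End TangentVectors.

Section MetricTopology.
Context {R : realType} {H : hilbertType R} (M : riemannianManifold H).

Lemma metric_ge0 (p : M) (v : tangent p) : 0 <= metric v v.
Proof.
have [->|v0] := eqVneq v 0; last exact/ltW/metric_gt0.
have := @metric_scalar _ _ M p 0 1 0 0; rewrite scale1r addr0 mul1r.
by move=> m00; lra.
Qed.

Lemma blinear2_le (B : blinear H (blinear H R^o)) w :
  `|B w w : R| <= `|B| * `|w| ^+ 2.
Proof.
apply: (le_trans (le_opnorm (B w) w)).
by rewrite expr2 mulrA; apply: ler_wpM2r => //; exact: (le_opnorm B w).
Qed.

Lemma blinear2_dist (A B : blinear H (blinear H R^o)) w :
  `|(A w w : R) - B w w| <= `|A - B| * `|w| ^+ 2.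
Proof. by have := blinear2_le (A - B) w; rewrite (blinearBE A B) blinearBE. Qed.

(** The metric is given as an equivalent norm at each point separately.  The
    constant is locally uniform since the metric depends continuously, in
    operator norm, on the point. *)
Lemma metric_equiv (p : M) (c : chart M H) (ac : atlas c) : chart_dom c p ->
  exists2 C, 0 < C & \forall y \near c p, forall x (cx : chart_dom c x), c x = y ->
    forall v : tangent x, `|v (ChartAt ac cx)| <= C * Num.sqrt (metric v v) /\
      Num.sqrt (metric v v) <= C * `|v (ChartAt ac cx)|.
Proof.
move=> cp; have [C0 C00 norm0] := metric_norm (ChartAt ac cp).
have [G Gs GE] := metric_smooth ac.
pose G0 := G (c p).
have G0w w : `|w| ^+ 2 <= C0 ^+ 2 * G0 w w.
  have [v vw] := tangent_exists (ChartAt ac cp) w.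
  rewrite /G0; have := GE p cp v v; rewrite vw => <-.
  have := (norm0 v).1; rewrite vw => le.
  rewrite -[metric v v]sqr_sqrtr; last exact: metric_ge0.
  by rewrite -exprMn ler_sqr// nnegrE// mulr_ge0 ?sqrtr_ge0// ltW.
have Gc : {for c p, continuous G}.
  have := Gs 0%N; rewrite /= continuous_open_subspace; last exact: open_chart_cod.
  by apply; rewrite inE; exact: chart_dom_cod.
(* C ^+ 2 dominates both 2 * C0 ^+ 2 and `|G0| + 1, the constants needed when
   G y is within (2 * C0 ^+ 2)^-1 and 1 of G0. *)
pose C := 2 * C0 + `|G0| + 1.
have G0ge : 0 <= `|G0| by [].
have C_gt0 : 0 < C by rewrite /C; lra.
have e1 : 0 < (2 * C0 ^+ 2)^-1 by rewrite invr_gt0 mulr_gt0 ?exprn_gt0.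
exists C => //; near=> y => x cx xy v.
have mE := GE x cx v v; set w := v _ in mE *.
have H1 : `|G0 - G y| <= (2 * C0 ^+ 2)^-1 by near: y; exact: cvgr_dist_le.
have H2 : `|G0 - G y| <= 1 by near: y; exact: cvgr_dist_le.
have diffle : `|(G0 w w : R) - G y w w| <= `|G0 - G y| * `|w| ^+ 2.
  exact: blinear2_dist.
have G0le : (G0 w w : R) <= `|G0| * `|w| ^+ 2.
  exact: le_trans (ler_norm _) (blinear2_le G0 w).
have m0 := metric_ge0 v.
rewrite -xy in diffle H1 H2; rewrite -mE in diffle.
have w2 : 0 <= `|w| ^+ 2 by exact: sqr_ge0.
have K1 : `|w| ^+ 2 <= C ^+ 2 * metric v v.
  have h1 : `|G0 - G (c x)| * `|w| ^+ 2 <= (2 * C0 ^+ 2)^-1 * `|w| ^+ 2.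
    by rewrite ler_wpM2r.
  move: diffle; rewrite ler_norml => /andP[_ h2].
  have h3 := G0w w.
  have h4 : C0 ^+ 2 * (G0 w w - metric v v) <= C0 ^+ 2 * ((2 * C0 ^+ 2)^-1 * `|w| ^+ 2).
    by rewrite ler_wpM2l ?sqr_ge0// (le_trans h2).
  have h5 : C0 ^+ 2 * ((2 * C0 ^+ 2)^-1 * `|w| ^+ 2) = `|w| ^+ 2 / 2.
    by field; rewrite gt_eqF.
  have h6 : 2 * C0 ^+ 2 * metric v v <= C ^+ 2 * metric v v.
    by rewrite ler_wpM2r// /C; nra.
  by rewrite h5 mulrBr in h4; lra.
have K2 : metric v v <= C ^+ 2 * `|w| ^+ 2.
  have h1 : `|G0 - G (c x)| * `|w| ^+ 2 <= 1 * `|w| ^+ 2 by rewrite ler_wpM2r.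
  move: diffle; rewrite ler_norml => /andP[h2 _].
  have h3 : (`|G0| + 1) * `|w| ^+ 2 <= C ^+ 2 * `|w| ^+ 2.
    by rewrite ler_wpM2r// /C; nra.
  by lra.
split.
  rewrite -(@ler_pXn2r _ 2%N)// ?nnegrE ?mulr_ge0 ?sqrtr_ge0 ?(ltW C_gt0)//.
  by rewrite exprMn sqr_sqrtr.
rewrite -(@ler_pXn2r _ 2%N)// ?nnegrE ?mulr_ge0 ?sqrtr_ge0 ?(ltW C_gt0)//.
by rewrite exprMn sqr_sqrtr.
Unshelve. all: by end_near. Qed.

(** For [q] in the closure of the ball of radius [r0 / 2], a segment [seg] of a
    chart [d] at [q] leads from some point [x] of the ball to [q].  Its speed in
    the chart [c] is at most [C1 * C2 * `|h|], which is less than [r0 / 2] when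
    [x] is close to [q]; so the segment stays in the ball of radius [r0]. *)
Lemma closed_chart_ball (p : M) (c : chart M H) : atlas c -> chart_dom c p ->
  exists2 r, 0 < r & closed [set x | chart_dom c x /\ `|c x - c p| <= r].
Proof.
move=> ac cp.
have [C1 C1_gt0 /nbhs_normP nC1] := metric_equiv ac cp.
have [e1 /= e1_gt0 he1] := iffLR (nbhs_normP _ _) (near_chart_cod (chart_dom_cod cp)).
have [e2 /= e2_gt0 he2] := nC1.
pose r0 := Num.min e1 e2; have r0_gt0 : 0 < r0 by rewrite lt_min e1_gt0.
exists (r0 / 2); first by rewrite divr_gt0.
move=> q qK.
have [d ad dq] := atlas_cover q.
suff cq : chart_dom c q.
  split=> //; rewrite leNgt; apply/negP => lt.
  have n2 : \forall x \near q, r0 / 2 < `|c x - c p|.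
    have cc := chart_fun_continuous_at cq.
    have : `|c x - c p| @[x --> q] --> `|c q - c p|.
      by apply: cvg_norm; apply: cvgB; [exact: cc|exact: cvg_cst].
    by move/cvgr_gt; apply.
  have [x [[_ le] gt]] := qK _ n2.
  by move: (lt_le_trans gt le); rewrite ltxx.
have [C2 C2_gt0 nC2] := metric_equiv ad dq.
have [e /= e_gt0 he] := iffLR (nbhs_normP _ _)
  (filterI nC2 (near_chart_cod (chart_dom_cod dq))).
pose del := Num.min e (r0 / (4 * (C1 * C2))).
have CC : 0 < C1 * C2 by rewrite mulr_gt0.
have del_gt0 : 0 < del by rewrite lt_min e_gt0 divr_gt0// mulr_gt0.
have nq : \forall x \near q, chart_dom d x /\ `|d q - d x| < del.
  apply: filterI; first exact: near_chart_dom.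
  by move/cvgrPdist_lt: (chart_fun_continuous_at dq); apply.
have [x [[cx xr] [dx xq]]] := qK _ nq.
pose h := d q - d x; pose seg (t : R) := d x + t *: h.
have seg1 : seg 1 = d q by rewrite /seg scale1r /h subrKC.
have seg0 : seg 0 = d x by rewrite /seg scale0r addr0.
have segB t : 0 <= t <= 1 -> `|d q - seg t| < e.
  move=> /andP[t0 t1].
  have -> : d q - seg t = (1 - t) *: h by rewrite /seg scalerBl scale1r /h opprD addrA.
  rewrite normrZ ger0_norm ?subr_ge0//.
  apply: (@le_lt_trans _ _ (1 * `|h|)).
    by rewrite ler_wpM2r// lerBlDr lerDl.
  by rewrite mul1r (lt_le_trans xq)// ge_min lexx.
have segd t : is_derive (t : R) 1 seg h.
  have [fd fE] := is_diffD (is_diff_cst (d x) t) (is_diff_scalel t h).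
  rewrite (_ : seg = cst (d x) + ( *:%R ^~ h))//.
  split; first exact: diff_derivable.
  by rewrite deriveE// fE /= add0r scale1r.
pose gam (t : R) := chart_inv d (seg t).
have -> : q = gam 1 by rewrite /gam seg1 chart_funK.
apply: (@curve_trapped _ _ _ c (c p) r0 (C1 * C2 * `|h|)).
- exact: manifold_hausdorff.
- by apply: mulr_ge0 => //; exact: ltW.
- move=> y yr; apply: he1 => /=; rewrite distrC (lt_le_trans yr)//.
  by rewrite ge_min lexx.
- move=> t t01; have [_ cod_t] := he _ (segB t t01).
  have segc : {for t, continuous seg}.
    by apply: differentiable_continuous; apply/derivable1_diffP; have [] := segd t.
  exact: (cvg_comp _ _ segc (chart_inv_continuous_at cod_t)).
- move=> t t01 ct ctr; have [m2 cod_t] := he _ (segB t t01).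
  have dt : chart_dom d (gam t) by exact: chart_cod_dom.
  have dgam : d (gam t) = seg t by rewrite chart_invK.
  pose dd := ChartAt ad dt; pose cc := ChartAt ac ct.
  have := transition_differentiable dd cc; rewrite /= dgam => Td.
  have [sd sE] := segd t; have sd' := iffLR (derivable1_diffP _ _) sd.
  have Fd : differentiable (transition d c \o seg) t by exact: differentiable_comp.
  split; first exact: diff_derivable.
  rewrite -[c \o gam]/(transition d c \o seg) deriveE// diff_comp//=.
  have -> : 'd seg t 1 = h by rewrite -deriveE.
  have [v vh] := tangent_exists dd h.
  have := tangentP v => /asboolP/(_ dd cc); rewrite vh /= dgam => <-.
  have [m2a m2b] := m2 _ dt dgam v.
  have e2t : `|c p - c (gam t)| < e2.
    by rewrite distrC (lt_le_trans ctr)// ge_min lexx orbT.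
  have [m1a m1b] := he2 _ e2t _ ct erefl v.
  apply: le_trans m1a _; rewrite -mulrA ler_pM2l//.
  by apply: le_trans m2b _; rewrite -/dd vh.
- by rewrite /gam seg0 chart_funK.
- rewrite /gam seg0 chart_funK//.
  have h1 : C1 * C2 * `|h| <= r0 / 4.
    rewrite -ler_pdivlMl// (le_trans (ltW xq))// /del ge_min; apply/orP; right.
    by rewrite invfM mulrA mulrC mulrA mulrAC mulrC mulrA [r0 * _]mulrC.
  by move: xr h1; lra.
Qed.

End MetricTopology.

(** * Extension of C^1 germs and C^1 enclosures *)

Section Extension.
Context {R : realType} {H : hilbertType R} (M : riemannianManifold H).

Lemma transition_dom_open (c d : chart M H) : open (transition_dom c d).
Proof.
rewrite openE => y [cy dy].
have ivc := chart_inv_continuous_at cy.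
have dny : \forall z \near y, chart_dom d (chart_inv c z) :=
  ivc _ (near_chart_dom dy).
exact: filterI (near_chart_cod cy) dny.
Qed.

Lemma C1_at_transition (c d : chart M H) y : atlas c -> atlas d ->
  transition_dom c d y -> C1_at (transition c d) y.
Proof.
move=> ac ad.
exact: (iffLR (Ck1P _ (transition_dom_open c d)) (atlas_compat ac ad 1)).
Qed.

(** Multiply by a bump function supported in a ball of the chart that is closed
    in [M]; the complement of this ball and the domain of the chart form an open
    cover of [M], and the extension by zero is C^1 on each of them. *)
Lemma C1_extension (p : M) (c : chart M H) (psi : H -> R^o) :
  atlas c -> chart_dom c p -> (forall y, C1_at psi y) ->
  exists2 phi : M -> R, C1 phi & \forall x \near p, phi x = psi (c x).
Proof.
move=> ac cp psiC; have [r r0 rK] := closed_chart_ball ac cp.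
set K := [set x | _] in rK.
have r2 : 0 < r / 2 by rewrite divr_gt0.
have [beta [betaC beta1 beta0]] := C1_bump (c p) r2.
have r2r : 2 * (r / 2) = r by rewrite mulrC divfK.
pose phi x : R := if `[< chart_dom c x >] then beta (c x) * psi (c x) else 0.
have phiE x : chart_dom c x -> phi x = beta (c x) * psi (c x).
  by move=> cx; rewrite /phi asboolT.
have phi0 x : ~ K x -> phi x = 0.
  move=> nK; rewrite /phi; case: asboolP => // cx; rewrite beta0 ?mul0r// r2r.
  by rewrite leNgt; apply/negP => lt; apply: nK; split=> //; exact: ltW.
exists phi.
  move=> d ad; apply/Ck1P; first exact: open_chart_cod.
  move=> y dy; have ivc := chart_inv_continuous_at dy.
  have [cy|ncy] := pselect (chart_dom c (chart_inv d y)).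
    have PsiC z : C1_at (fun z => beta z * psi z : R^o) z by exact: C1_atM.
    apply: near_eq_C1_at (C1_at_comp (C1_at_transition ad ac (conj dy cy)) (PsiC _)).
    have : \forall z \near y, chart_dom c (chart_inv d z) := ivc _ (near_chart_dom cy).
    by apply: filterS => z cz /=; rewrite phiE.
  have nK : ~ K (chart_inv d y) by case.
  have oK : \forall x \near chart_inv d y, ~ K x.
    by apply: open_nbhs_nbhs; split=> //; exact: closed_openC.
  apply: near_eq_C1_at (C1_at_cst 0 y).
  have : \forall z \near y, ~ K (chart_inv d z) := ivc _ oK.
  by apply: filterS => z nKz /=; rewrite phi0.
near=> x; rewrite phiE; last by near: x; exact: near_chart_dom.
rewrite beta1 ?mul1r// distrC; near: x.
by move/cvgrPdist_le: (chart_fun_continuous_at cp); apply.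
Unshelve. all: by end_near. Qed.

(** In a chart, [F p + L h - theta h] and [F p + L h + theta h], where [theta] is
    a C^1 majorant of the first-order remainder of [F]. *)
Lemma C1_enclosure (F : M -> R) (p : M) : mdifferentiable F p ->
  exists u v : M -> R, [/\ C1 u, C1 v, u p = F p, v p = F p &
    \forall x \near p, u x <= F x <= v x].
Proof.
move=> dF; have [c] := chart_at_exists p.
have [L LP] := differentiable_is_diff (dF c).
pose a := c p; pose G (y : H) : R := F (chart_inv c y).
have cp := chart_at_dom c; have ac := chart_at_atlas c.
have Ga : G a = F p by rewrite /G chart_funK.
have [theta [thetaC theta0 le]] : exists theta : H -> R^o, [/\
    forall x, C1_at theta x, theta 0 = 0 &
    \forall y \near a, `|G y - G a - L (y - a)| <= theta (y - a)].
  have [e e0|th [thC th0 thle]] := @C1_majorant R H (fun h => G (h + a) - G a - L h).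
    have := iffLR (is_diffP _ _ _) LP e e0; rewrite (near_shift 0 a) subr0.
    by apply: filterS => h /=; rewrite addrK.
  exists th; split=> //; rewrite (near_shift 0 a) subr0.
  by apply: filterS thle => h /=; rewrite addrK.
have LC y : C1_at (fun y => L (y - a)) y.
  by apply: C1_at_shift; exact: C1_at_linear.
have tC y : C1_at (fun y => theta (y - a)) y by exact: C1_at_shift.
pose psi1 y : R^o := L (y - a) - (theta (y - a) - F p).
pose psi2 y : R^o := L (y - a) - (- F p - theta (y - a)).
have [|u uC uE] := @C1_extension p c psi1 ac cp.
  by move=> y; apply: C1_atB => //; apply: C1_atB => //; exact: C1_at_cst.
have [|v vC vE] := @C1_extension p c psi2 ac cp.
  by move=> y; apply: C1_atB => //; apply: C1_atB => //; exact: C1_at_cst.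
exists u, v; split=> //.
- by rewrite (nbhs_singleton uE) /psi1 subrr linear0 theta0 !sub0r opprK.
- by rewrite (nbhs_singleton vE) /psi2 subrr linear0 theta0 subr0 sub0r opprK.
have cc := chart_fun_continuous_at cp.
have lep : \forall x \near p,
  `|G (c x) - G a - L (c x - a)| <= theta (c x - a) := cc _ le.
near=> x.
have -> : u x = psi1 (c x) by near: x.
have -> : v x = psi2 (c x) by near: x.
have cx : chart_dom c x by near: x; exact: near_chart_dom.
have : `|G (c x) - G a - L (c x - a)| <= theta (c x - a) by near: x.
rewrite Ga /G chart_funK// => h.
pose l : R := L (c x - a); pose t : R := theta (c x - a).
have {h} : `|F x - F p - l| <= t by exact: h.
rewrite (_ : psi1 (c x) = l - (t - F p))// (_ : psi2 (c x) = l - (- F p - t))//.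
rewrite ler_norml => /andP[h1 h2].
by apply/andP; split; lra.
Unshelve. all: by end_near. Qed.

Lemma near_chart_inv (p : M) (c : chart M H) (P : set M) : chart_dom c p ->
  (\forall x \near p, P x) -> \forall y \near c p, P (chart_inv c y).
Proof.
move=> cp Pp; have := chart_inv_continuous_at (chart_dom_cod cp).
by rewrite /prop_for /continuous_at chart_funK// => ivc; exact: ivc _ Pp.
Qed.

Lemma mdiff_is_diff (phi : M -> R) (p : M) (c : chart_at p) (L : blinear H R^o) :
  mdifferentiable phi p -> is_diff (c p) (phi \o chart_inv c : H -> R^o) L ->
  forall w : tangent p, mdiff phi p w = L (w c).
Proof. by move=> dphi [_ LE] w; have := mdiffE dphi c w; rewrite LE. Qed.

(** [v - u] has a local minimum at [p]. *)
Lemma mdiff_touch (u v : M -> R) (p : M) :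
  mdifferentiable u p -> mdifferentiable v p ->
  (\forall x \near p, v p - u p <= v x - u x) -> mdiff u p = mdiff v p.
Proof.
move=> du dv le; apply/val_inj/funext => w /=; have [c] := chart_at_exists p.
have [Lu fu] := differentiable_is_diff (du c).
have [Lv fv] := differentiable_is_diff (dv c).
have d : is_diff (c p) (fun y => v (chart_inv c y) - u (chart_inv c y) : R^o)
  (Lv - Lu : blinear H R^o) := is_diffB fv fu.
have cp := chart_at_dom c.
have L0 : Lv - Lu = 0.
  apply: (local_min_diff0 d); have := near_chart_inv cp le; apply: filterS => y.
  by rewrite chart_funK// => h; move: h; lra.
apply: etrans (mdiff_is_diff du fu w) (etrans _ (esym (mdiff_is_diff dv fv w))).
by have -> : Lv = Lu by apply/eqP; rewrite -subr_eq0 L0.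
Qed.

End Extension.

(** * Sub- and superdifferentials *)

Section Main.
Context {R : realType} {H : hilbertType R} (M : riemannianManifold H).
Implicit Types f : M -> \bar R.

Lemma near_below_fine f (phi : M -> R) (p : M) : f p \is a fin_num ->
  (\forall x \near p, f x \is a fin_num) ->
  (\forall x \near p, (f p - (phi p)%:E <= f x - (phi x)%:E)%E) <->
  (\forall x \near p, fine (f p) - phi p <= fine (f x) - phi x).
Proof.
move=> fp nfx; split; apply: filterS2 nfx => x fx.
  by rewrite -(fineK fp) -(fineK fx) -!EFinB lee_fin.
by rewrite -(fineK fp) -(fineK fx) -!EFinB lee_fin.
Qed.

Lemma near_above_fine f (phi : M -> R) (p : M) : f p \is a fin_num ->
  (\forall x \near p, f x \is a fin_num) ->
  (\forall x \near p, (f x - (phi x)%:E <= f p - (phi p)%:E)%E) <->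
  (\forall x \near p, fine (f x) - phi x <= fine (f p) - phi p).
Proof.
move=> fp nfx; split; apply: filterS2 nfx => x fx.
  by rewrite -(fineK fp) -(fineK fx) -!EFinB lee_fin.
by rewrite -(fineK fp) -(fineK fx) -!EFinB lee_fin.
Qed.

Lemma Dminus_differentiable f (p : M) : frechet_differentiable f p ->
  Dminus f p = [set frechet_diff f p].
Proof.
move=> [fin df]; have fp := nbhs_singleton fin; apply/seteqP; split.
  move=> _ [phi [phiC /(near_below_fine _ fp fin) le] <-].
  by apply: mdiff_touch => //; exact: C1_mdifferentiable.
move=> _ ->; have [u [v [uC _ up _ le]]] := C1_enclosure df.
exists u; last first.
  apply: mdiff_touch => //; first exact: C1_mdifferentiable.
  by apply: filterS le => x /=; rewrite up /= => /andP[]; lra.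
split=> //; apply/(near_below_fine _ fp fin).
by apply: filterS le => x /=; rewrite up /= => /andP[]; lra.
Qed.

Lemma Dplus_differentiable f (p : M) : frechet_differentiable f p ->
  Dplus f p = [set frechet_diff f p].
Proof.
move=> [fin df]; have fp := nbhs_singleton fin; apply/seteqP; split.
  move=> _ [phi [phiC /(near_above_fine _ fp fin) le] <-].
  apply/esym/mdiff_touch => //; first exact: C1_mdifferentiable.
  by apply: filterS le => x /=; lra.
move=> _ ->; have [u [v [_ vC _ vp le]]] := C1_enclosure df.
exists v; last first.
  apply/esym/mdiff_touch => //; first exact: C1_mdifferentiable.
  by apply: filterS le => x /=; rewrite vp /= => /andP[]; lra.
split=> //; apply/(near_above_fine _ fp fin).
by apply: filterS le => x /=; rewrite vp /= => /andP[]; lra.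
Qed.

(** The squeeze takes place in an arbitrary chart, where equality of the two
    covectors becomes equality of the linear maps because every vector of [H]
    is the coordinate of a tangent vector. *)
Lemma mdifferentiable_enclosed (u F v : M -> R) (p : M) :
  mdifferentiable u p -> mdifferentiable v p ->
  (\forall x \near p, u x - u p <= F x - F p <= v x - v p) ->
  mdifferentiable F p.
Proof.
move=> du dv le c; have cp := chart_at_dom c.
have duv : mdiff u p = mdiff v p.
  by apply: mdiff_touch => //; apply: filterS le => x /andP[]; lra.
have [Lu fu] := differentiable_is_diff (du c).
have [Lv fv] := differentiable_is_diff (dv c).
have LL : Lu = Lv.
  apply/val_inj/funext => h /=; have [w <-] := tangent_exists c h.
  apply: etrans (esym (mdiff_is_diff du fu w)) (etrans _ (mdiff_is_diff dv fv w)).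
  by rewrite duv.
rewrite -LL in fv.
have shiftE (w : M -> R) :
    w (chart_inv c (c p)) - (w p - F p) = F (chart_inv c (c p)).
  by rewrite (chart_funK cp) subKr.
have near_le : \forall y \near c p,
    u (chart_inv c y) - (u p - F p) <= F (chart_inv c y) /\
    F (chart_inv c y) <= v (chart_inv c y) - (v p - F p).
  by have := near_chart_inv cp le; apply: filterS => y /andP[h1 h2]; split; lra.
by have [] := squeeze_is_diff (is_diff_subc (u p - F p) fu)
  (is_diff_subc (v p - F p) fv) (shiftE u) (shiftE v) near_le.
Qed.

(** A function touching [f] from above bounds it near [p], so [f] is finite
    there. *)
Lemma sub_super_differentiable f (p : M) : (forall x, -oo < f x)%E ->
  subdifferentiable f p -> superdifferentiable f p -> frechet_differentiable f p.
Proof.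
move=> fNy [fpy [_ [u [uC uf] _]]] [_ [_ [v [vC vf] _]]].
have fp : f p \is a fin_num by rewrite fin_numElt fNy.
have fin : \forall x \near p, f x \is a fin_num.
  apply: filterS vf => x; rewrite fin_numElt fNy /= => vx.
  have : (f x <= (fine (f p) - v p + v x)%:E)%E.
    by rewrite EFinD EFinB fineK// -leeBlDr.
  by move/le_lt_trans; apply; exact: ltry.
split=> //; apply: (@mdifferentiable_enclosed u _ v).
- exact: C1_mdifferentiable.
- exact: C1_mdifferentiable.
have /(near_below_fine _ fp fin) uF := uf; have /(near_above_fine _ fp fin) vF := vf.
by move: uF vF; apply: filterS2 => x /=; lra.
Qed.

End Main.

Theorem proposition4p6 (R : realType) (H : hilbertType R)
    (M : riemannianManifold H) (f : M -> \bar R)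
    (f_gtNy : forall x : M, (-oo < f x)%E) (p : M) :
  (frechet_differentiable f p <->
     subdifferentiable f p /\ superdifferentiable f p) /\
  (frechet_differentiable f p ->
     [set frechet_diff f p] = Dminus f p /\ Dminus f p = Dplus f p).
Proof.
split; last by move=> df; rewrite Dminus_differentiable// Dplus_differentiable.
split=> [df|[]]; last exact: sub_super_differentiable.
have fpy : edom f p.
  by have [/nbhs_singleton] := df; rewrite fin_numElt => /andP[].
split; split=> //; exists (frechet_diff f p).
  by rewrite Dminus_differentiable.
by rewrite Dplus_differentiable.
Qed.
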